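(* Let $p\in[1,\infty]$, $d\in\mathbb{N}=\{1,2,\dots\}$, and let $F_d\in\{F_d^{\,\mathrm{mon}},F_d^{\,\mathrm{con}}\}$. Then for every integer $n\ge0$ and every $\varepsilon>0$, $$e_n^{\mathrm{int}}(F_d)\le e_n^{\mathrm{app}}(F_d)\qquad\text{and}\qquad n^{\mathrm{int}}(F_d,\varepsilon)\le n^{\mathrm{app}}(F_d,\varepsilon).$$ In particular, for every $p\in[1,\infty]$, the $L_p$ approximation problem suffers from the curse of dimensionality for both classes $F_d^{\,\mathrm{mon}}$ and $F_d^{\,\mathrm{con}}$.
   Context: For $d\in\mathbb{N}$, let $F_d^{\,\mathrm{mon}}$ be the set of all functions $f:[0,1]^d\to[0,1]$ that are monotone, i.e. non-decreasing in each variable when the other variables are fixed, and let $F_d^{\,\mathrm{con}}$ be the set of all convex functions $f:[0,1]^d\to[0,1]$. The integration problem is to approximate $\mathrm{INT}_d(f)=\int_{[0,1]^d}f(x)\,dx$; the $L_p$ approximation problem is to approximate $\mathrm{APP}_d(f)=f$ as an element of $L_p([0,1]^d)$. For an integer $n\ge 0$, an algorithm $A_n$ using $n$ function values has the form $A_n(f)=\phi_n(f(t_1),\dots,f(t_n))$, where the sample points $t_j\in[0,1]^d$ are arbitrary and may be chosen adaptively ($t_1$ is fixed and, for $j\ge2$, $t_j$ may depend arbitrarily on the already computed values $f(t_1),\dots,f(t_{j-1})$), and $\phi_n$ is an arbitrary mapping, $\phi_n:\mathbb{R}^n\to\mathbb{R}$ for integration and $\phi_n:\mathbb{R}^n\to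 L_p([0,1]^d)$ for $L_p$ approximation. For $n=0$, $A_0$ is a constant element of $\mathbb{R}$, respectively of $L_p([0,1]^d)$. The $n$th minimal worst case errors are $$e_n^{\mathrm{int}}(F_d)=\inf_{A_n}\sup_{f\in F_d}|\mathrm{INT}_d(f)-A_n(f)|,\qquad e_n^{\mathrm{app}}(F_d)=\inf_{A_n}\sup_{f\in F_d}\|f-A_n(f)\|_{L_p([0,1]^d)},$$ with infima over all algorithms of the respective form. The information complexities are $$n^{\mathrm{int}}(F_d,\varepsilon)=\min\{n\ge0: e_n^{\mathrm{int}}(F_d)\le\varepsilon\},\qquad n^{\mathrm{app}}(F_d,\varepsilon)=\min\{n\ge0: e_n^{\mathrm{app}}(F_d)\le\varepsilon\},$$ with the convention $\min\emptyset=\infty$. A problem suffers from the curse of dimensionality if its information complexity is at least exponential in $d$ for some fixed $\varepsilon$, i.e. there exist $\varepsilon>0$, $c>0$ and $\gamma>1$ such that the information complexity at $\varepsilon$ is at least $c\,\gamma^d$ for all $d\in\mathbb{N}$. *)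

(* Defs.v *)
From HB Require Import structures.
From mathcomp Require Import all_boot all_order all_algebra.
From mathcomp Require Import all_classical all_reals all_analysis.

Set Implicit Arguments.
Unset Strict Implicit.
Unset Printing Implicit Defensive.

Import Order.TTheory GRing.Theory Num.Theory.
Import numFieldNormedType.Exports.

Local Open Scope classical_set_scope.
Local Open Scope ring_scope.

(* Points of R^d; [measurableTypeR R] is R with its Borel sigma-algebra, and
   tuples carry the product sigma-algebra. *)
Notation point R d := (d.-tuple (measurableTypeR R)) (only parsing).

Definition cube (R : realType) (d : nat) : set (point R d) :=
  [set x | forall i : 'I_d, 0 <= tnth x i <= 1].

Definition lebesgue01 (R : realType) : set (measurableTypeR R) -> \bar R :=
  mrestr (@lebesgue_measure R) (measurable_itv `[0, 1]).

Section lebesgue01_probability.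
Variable R : realType.

HB.instance Definition _ := Measure.on (@lebesgue01 R).

Let lebesgue01_setT : @lebesgue01 R setT = 1%E.
Proof.
by rewrite /lebesgue01 /mrestr setTI lebesgue_measure_itv/= lte01 sube0.
Qed.

HB.instance Definition _ :=
  Measure_isProbability.Build _ _ _ (@lebesgue01 R) lebesgue01_setT.

End lebesgue01_probability.

Definition cons_point (R : realType) (d : nat)
    (x : measurableTypeR R * point R d) : point R d.+1 :=
  [the d.+1.-tuple (measurableTypeR R) of x.1 :: x.2].

Lemma measurable_cons_point (R : realType) (d : nat) :
  measurable_fun setT (@cons_point R d).
Proof. exact: measurable_cons. Qed.

HB.instance Definition _ (R : realType) (d : nat) :=
  isMeasurableFun.Build _ _ _ _ (@cons_point R d)
    (@measurable_cons_point R d).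

(* The d-fold product of Lebesgue measure on [0,1], as a Borel probability
   measure on R^d concentrated on the cube. *)
Fixpoint borel_cube (R : realType) (d : nat) : probability (point R d) R :=
  match d with
  | 0 => \d_([tuple] : point R 0)
  | d'.+1 =>
      distribution (@lebesgue01 R \x borel_cube R d')%E (@cons_point R d')
  end.

(* Functions that are monotone on the cube are Lebesgue measurable but in
   general not Borel measurable, so the product measure has to be completed:
   [cube_type R d] is R^d with the Caratheodory sigma-algebra, which is complete
   and in which the complement of the cube is a null set. *)
Definition cube_type (R : realType) (d : nat) :=
  caratheodory_type ((borel_cube R d)^*)%mu.

Definition lebesgue_cube (R : realType) (d : nat) :
    {measure set (cube_type R d) -> \bar R} :=
  @completed_measure_extension _ _ _ (borel_cube R d).

(* Functions [0,1]^d -> [0,1] are represented by functions on R^d whose values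
   outside the cube are irrelevant: algorithms sample in the cube only, and the
   measure does not see the complement of the cube. *)
Definition unit_valued (R : realType) (d : nat) (f : point R d -> R) :=
  forall x, cube x -> 0 <= f x <= 1.

Definition F_mon (R : realType) (d : nat) : set (point R d -> R) :=
  [set f | unit_valued f /\
    forall (i : 'I_d) (x y : point R d), cube x -> cube y ->
      (forall j, j != i -> tnth x j = tnth y j) ->
      tnth x i <= tnth y i -> f x <= f y].

Definition segment_point (R : realType) (d : nat) (t : R) (x y : point R d) :
    point R d :=
  [tuple t * tnth x i + (1 - t) * tnth y i | i < d].

Definition F_con (R : realType) (d : nat) : set (point R d -> R) :=
  [set f | unit_valued f /\
    forall (t : R) (x y : point R d), 0 <= t <= 1 -> cube x -> cube y ->
      f (segment_point t x y) <= t * f x + (1 - t) * f y].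

(* [sample y] is the next sample point, as a function of the list [y] of the
   values computed so far; in particular the first point is [sample [::]]. *)
Record algorithm (R : realType) (d n : nat) (G : Type) := Algorithm {
  sample : seq R -> point R d ;
  sample_cube : forall y, cube (sample y) ;
  output : n.-tuple R -> G }.

Fixpoint information (R : realType) (d : nat) (t : seq R -> point R d)
    (f : point R d -> R) (n : nat) : n.-tuple R :=
  match n with
  | 0 => [tuple]
  | n'.+1 => let y := information t f n' in [tuple of rcons y (f (t y))]
  end.

Definition run (R : realType) (d n : nat) (G : Type) (A : algorithm R d n G)
    (f : point R d -> R) : G :=
  output A (information (sample A) f n).

Definition INT (R : realType) (d : nat) (f : point R d -> R) : R :=
  \int[lebesgue_cube R d]_(x in @cube R d) f x.

Definition e_int (R : realType) (d : nat) (F : set (point R d -> R)) (n : nat) :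
    \bar R :=
  ereal_inf [set ereal_sup [set (`|INT f - run A f|)%:E | f in F]
            | A in [set: algorithm R d n R]].

(* [run A f] is an element of the quotient space L_p([0,1]^d), coerced to one of
   its representatives. *)
Definition e_app (R : realType) (p : \bar R) (p1 : (1 <= p)%E) (d : nat)
    (F : set (point R d -> R)) (n : nat) : \bar R :=
  ereal_inf [set ereal_sup [set 'N[lebesgue_cube R d]_p
                                  [EFin \o (f \- run A f)%R]%E | f in F]
            | A in [set: algorithm R d n (LspaceType (lebesgue_cube R d) p1)]].

Definition complexity (R : realType) (e : nat -> \bar R) (eps : R) : \bar R :=
  if pselect (exists n, `[< (e n <= eps%:E)%E >]) is left ex_n
  then (ex_minn ex_n)%:R%:E else +oo%E.

Definition n_int (R : realType) (d : nat) (F : set (point R d -> R)) (eps : R) :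
    \bar R :=
  complexity (e_int F) eps.

Definition n_app (R : realType) (p : \bar R) (p1 : (1 <= p)%E) (d : nat)
    (F : set (point R d -> R)) (eps : R) : \bar R :=
  complexity (e_app p1 F) eps.

(* [N d eps] is the information complexity at [eps] in dimension [d]. *)
Definition curse_of_dimensionality (R : realType) (N : nat -> R -> \bar R) :=
  exists eps c gamma : R, [/\ 0 < eps, 0 < c, 1 < gamma &
    forall d : nat, (0 < d)%N -> ((c * gamma ^+ d)%:E <= N d eps)%E].

(* Main.v *)
Require Import Defs.
From mathcomp Require Import all_boot all_order all_algebra.
From mathcomp Require Import all_classical all_reals all_analysis.
From mathcomp Require Import measurable_realfun ess_sup_inf.
From mathcomp Require Import ring lra.

Import Order.TTheory GRing.Theory Num.Theory.
Import numFieldNormedType.Exports.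

Local Open Scope classical_set_scope.
Local Open Scope ring_scope.

Set Implicit Arguments.
Unset Strict Implicit.
Unset Printing Implicit Defensive.

(** Integrating the output of an approximation algorithm gives an integration
    algorithm with the same information.  Its error on [f] is the absolute value
    of an integral of [f - A f] over a set of measure 1, hence at most the
    L_1 norm, hence at most the L_p norm of [f - A f] ([dist_integral_le_Lnorm],
    [e_int_le_e_app]).  What needs an argument is that [f] is Lebesgue
    measurable:
    - a monotone [f] lies between the step functions that take its values at the
      lower and at the upper corners of the cells of a grid of mesh [1/n]; the
      integral of their difference telescopes to at most [d/n]
      ([integral_oscillation]), so [f] agrees almost everywhere with a Borel
      function ([F_mon_measurable]);
    - a convex [f] with values in [0,1] is Lipschitz away from the boundary of
      the cube, so there it is the pointwise limit of such step functions, and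
      the boundary is a null set ([F_con_measurable]).

    By the comparison of the complexities, the curse for approximation follows
    from the curse for integration, that is, from fooling functions: two
    functions of the class which agree at the [n] points chosen by the algorithm
    and whose integrals differ by at least [delta * (1 - n * q ^+ d)] with
    [q < 1], so that [n] must be of order [q ^- d] ([curse_from_fooling]).
    - Monotone case: answer 1 at [z] if the box above [z] has at most the volume
      of the box below [z], and 0 otherwise.  The smaller of the two boxes has
      volume at most [2 ^- d], because [z (1 - z) <= 1/4].  The least and the
      greatest monotone functions compatible with the answers are 0, respectively
      1, outside of at most [n] such boxes ([monotone_fooling]).
    - Convex case: answer 0 everywhere.  The fooling function is the largest
      convex function that is at most 1 and vanishes at the sample points.  With
      [c] the centre of the cube, it is at least 1/12 at every [x] with
      [<x - c, x - z> >= d/24] for all sample points [z].  For a random [x] the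
      mean of [<x - c, x - z>] is [d/12], and by Chernoff's method the
      exceptional set of one [z] has exponentially small measure
      ([borel_cube_near_center], [convex_fooling]). *)

(** * Integration with respect to the product measure *)

Section product_measure.
Variable R : realType.
Local Open Scope ereal_scope.

Lemma integral_prob_cst d (T : measurableType d) (P : probability T R) (c : \bar R) :
  \int[P]_x cst c x = c.
Proof.
rewrite integral_cst// -[RHS]mule1; congr (_ * _); exact: probability_setT.
Qed.

Lemma ge0_integral_lebesgue01 (f : measurableTypeR R -> \bar R) :
  measurable_fun [set: measurableTypeR R] f -> (forall x, 0 <= f x) ->
  \int[@lebesgue01 R]_x f x = \int[@lebesgue_measure R]_(x in `[0%R, 1%R]) f x.
Proof.
move=> mf f0.
have m01 : measurable (`[0%R, 1%R] : set (measurableTypeR R)).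
  exact: measurable_itv.
rewrite (@ge0_negligible_integral _ _ _ (@lebesgue01 R) setT (~` `[0%R, 1%R]))//=.
- rewrite setTD setCK; apply: eq_measure_integral => A mA A01.
  by rewrite /= /lebesgue01 /mrestr setIidl.
- exact: measurableC.
- by rewrite /lebesgue01 /mrestr setICl measure0.
Qed.

Lemma ge0_integral_borel_cubeS d (f : d.+1.-tuple (measurableTypeR R) -> \bar R) :
  measurable_fun setT f -> (forall x, 0 <= f x) ->
  \int[borel_cube R d.+1]_x f x =
  \int[@lebesgue01 R]_a \int[borel_cube R d]_x f (cons_point (a, x)).
Proof.
move=> mf f0 /=; rewrite ge0_integral_distribution//.
rewrite fubini_tonelli1//.
- by apply: measurableT_comp => //; exact: measurable_cons_point.
- by move=> x; exact: f0.
Qed.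

Lemma ge0_integral_borel_cubeS_swap d
    (f : d.+1.-tuple (measurableTypeR R) -> \bar R) :
  measurable_fun setT f -> (forall x, 0 <= f x) ->
  \int[borel_cube R d.+1]_x f x =
  \int[borel_cube R d]_x \int[@lebesgue01 R]_a f (cons_point (a, x)).
Proof.
move=> mf f0 /=; rewrite ge0_integral_distribution//.
rewrite fubini_tonelli2//.
- by apply: measurableT_comp => //; exact: measurable_cons_point.
- by move=> x; exact: f0.
Qed.

Lemma measurable_prod_tnth d (w : 'I_d -> measurableTypeR R -> R) :
  (forall i, measurable_fun [set: measurableTypeR R] (w i)) ->
  measurable_fun [set: d.-tuple (measurableTypeR R)]
    (fun x => (\prod_(i < d) w i (tnth x i))%R : R).
Proof.
move=> mw; apply: measurable_prod => i _.
apply: (measurableT_comp (mw i)); exact: measurable_tnth.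
Qed.

Lemma integral_prod_le d (w : 'I_d -> measurableTypeR R -> R) (q : 'I_d -> R) :
  (forall i, measurable_fun [set: measurableTypeR R] (w i)) ->
  (forall i x, 0 <= w i x)%R ->
  (forall i, \int[@lebesgue01 R]_x (w i x)%:E <= (q i)%:E) ->
  \int[borel_cube R d]_x (\prod_(i < d) w i (tnth x i))%:E <=
  (\prod_(i < d) q i)%:E.
Proof.
elim: d w q => [|d IH] w q mw w0 wq.
  rewrite /= integral_dirac//; last first.
    by apply/measurable_EFinP; exact: measurable_prod_tnth.
  by rewrite !big_ord0 diracT mul1e.
have q0 i : (0 <= q i)%R.
  rewrite -lee_fin; apply: le_trans (wq i).
  by apply: integral_ge0 => x _; rewrite lee_fin.
have p0 : (0 <= \prod_(i < d) q (lift ord0 i))%R by apply: prodr_ge0.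
rewrite ge0_integral_borel_cubeS//; last 2 first.
- by apply/measurable_EFinP; exact: measurable_prod_tnth.
- by move=> x; rewrite lee_fin prodr_ge0.
rewrite big_ord_recl.
apply: (@le_trans _ _ (\int[@lebesgue01 R]_a
   ((w ord0 a)%:E * (\prod_(i < d) q (lift ord0 i))%:E))); last first.
  rewrite ge0_integralZr//.
  - by rewrite EFinM lee_wpmul2r// lee_fin.
  - by apply/measurable_EFinP; exact: mw.
  - by move=> x _; rewrite lee_fin.
have E a : \int[borel_cube R d]_x
    (\prod_(i < d.+1) w i (tnth (cons_point (a, x)) i))%:E =
  (w ord0 a)%:E * \int[borel_cube R d]_x
    (\prod_(i < d) w (lift ord0 i) (tnth x i))%:E.
  rewrite -ge0_integralZl_EFin//.
  - apply: eq_integral => x _; rewrite big_ord_recl tnth0 EFinM.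
    by under eq_bigr do rewrite tnthS.
  - by move=> x _; rewrite lee_fin prodr_ge0.
  - apply/measurable_EFinP.
    by apply: (@measurable_prod_tnth d (fun i => w (lift ord0 i))).
have i0 : 0 <= \int[borel_cube R d]_x
    (\prod_(i < d) w (lift ord0 i) (tnth x i))%:E.
  by apply: integral_ge0 => x _; rewrite lee_fin prodr_ge0.
under eq_integral do rewrite E.
apply: ge0_le_integral => //.
- by move=> x _; rewrite mule_ge0// lee_fin.
- by apply: emeasurable_funM => //; apply/measurable_EFinP; exact: mw.
- by apply: emeasurable_funM => //; apply/measurable_EFinP; exact: mw.
- by move=> x _; rewrite lee_wpmul2l ?lee_fin//;
  exact: (IH (fun i => w (lift ord0 i)) (fun i => q (lift ord0 i))).
Qed.

(** A Markov inequality for product weights.  The boxes of the monotone case, with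
    indicators as weights, and the exceptional sets of the convex case, with
    exponential weights, both get their exponentially small measure from it. *)
Lemma borel_cube_le_prod d (S : set (d.-tuple (measurableTypeR R)))
    (w : 'I_d -> measurableTypeR R -> R) (q : 'I_d -> R) :
  measurable S ->
  (forall i, measurable_fun [set: measurableTypeR R] (w i)) ->
  (forall i x, 0 <= w i x)%R ->
  (forall i, \int[@lebesgue01 R]_x (w i x)%:E <= (q i)%:E) ->
  (forall x, S x -> 1 <= \prod_(i < d) w i (tnth x i))%R ->
  borel_cube R d S <= (\prod_(i < d) q i)%:E.
Proof.
move=> mS mw w0 wq Sw; apply: le_trans (integral_prod_le mw w0 wq).
have -> : borel_cube R d S = \int[borel_cube R d]_x (\1_S x)%:E.
  by rewrite integral_indic// setIT.
apply: ge0_le_integral => //.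
- exact/measurable_EFinP.
- by apply/measurable_EFinP; exact: measurable_prod_tnth.
- move=> x _; rewrite lee_fin indicE; have [Sx|Sx] := pselect (S x).
    by rewrite mem_set//; exact: Sw.
  by rewrite memNset// prodr_ge0.
Qed.

(** The product bound with the indicator of [A] as the [i]-th weight and 1 as
    every other weight. *)
Lemma borel_cube_coordinate0 d (i : 'I_d) (A : set (measurableTypeR R)) :
  measurable A -> lebesgue01 A = 0 ->
  borel_cube R d [set x | A (tnth x i)] = 0.
Proof.
move=> mA A0; apply/eqP; rewrite eq_le measure_ge0 andbT.
have mS : measurable [set x : d.-tuple (measurableTypeR R) | A (tnth x i)].
  rewrite -[X in measurable X]setTI.
  exact: (@measurable_tnth _ (measurableTypeR R) d i).
have := @borel_cube_le_prod d _
  (fun j => if j == i then \1_A else cst 1%R)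
  (fun j => if j == i then 0%R else 1%R) mS.
rewrite (bigD1 i)//= eqxx mul0r => H; apply: H.
- by move=> j; case: ifP => _; [exact: measurable_indic | exact: measurable_cst].
- by move=> j x; case: ifP => _ //=; rewrite ler01.
- move=> j; case: ifP => _.
    rewrite (_ : \int[_]_x _ = lebesgue01 A) ?A0//.
    by rewrite integral_indic// setIT.
  rewrite (_ : \int[_]_x _ = 1%:E)//.
  rewrite (_ : (fun x : measurableTypeR R => _) = cst 1%:E)//.
  by rewrite integral_cst// mul1e; exact: (@probability_setT _ _ _ (@lebesgue01 R)).
- move=> x Ax; rewrite (bigD1 i)//= eqxx big1 ?mulr1.
    by rewrite indicE mem_set.
  by move=> j /negbTE ->.
Qed.

(** The complement of the open cube is a Borel null set, so a function needs to be
    controlled only here. *)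
Definition open_cube d : set (d.-tuple (measurableTypeR R)) :=
  [set x | forall i : 'I_d, 0 < tnth x i < 1]%R.

Lemma open_cubeW d : @open_cube d `<=` @cube R d.
Proof. by move=> x xo i; have /andP[/ltW-> /ltW->] := xo i. Qed.

Lemma setC_open_cube d : ~` @open_cube d =
  \big[setU/set0]_(i < d) [set x | (~` `]0%R, 1%R[) (tnth x i)].
Proof.
apply/seteqP; split=> x.
  move=> /existsNP[i] xi.
  case: d x i xi => [|d] x i xi; first by case: i {xi} => -[].
  rewrite -bigcup_mkord_ord; exists i => //=; rewrite inord_val.
  by rewrite in_itv.
case: d x => [|d] x; first by rewrite big_ord0.
rewrite -bigcup_mkord_ord => -[i _ /= xi] xo; apply: xi.
by rewrite in_itv/=; exact: xo.
Qed.

End product_measure.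

(** * Grids and monotone functions *)

Section grid.
Variable R : realType.
Implicit Types (n d : nat).

(** Moving from [x] to [y] by changing one coordinate at a time, in increasing
    order, reduces statements about arbitrary pairs of points to the coordinatewise
    conditions in the definitions of the two classes. *)
Definition mix d (x y : d.-tuple (measurableTypeR R)) (k : nat) :
    d.-tuple (measurableTypeR R) :=
  [tuple if (i < k)%N then tnth y i else tnth x i | i < d].

Lemma mix0 d (x y : d.-tuple (measurableTypeR R)) : mix x y 0 = x.
Proof. by apply/eq_from_tnth => i; rewrite tnth_mktuple. Qed.

Lemma mix_size d (x y : d.-tuple (measurableTypeR R)) : mix x y d = y.
Proof. by apply/eq_from_tnth => i; rewrite tnth_mktuple ltn_ord. Qed.

Lemma mix_cube d (x y : d.-tuple (measurableTypeR R)) k :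
  cube x -> cube y -> cube (mix x y k).
Proof. by move=> cx cy i; rewrite tnth_mktuple; case: ifP. Qed.

Lemma tnth_mix_eq d (x y : d.-tuple (measurableTypeR R)) (k i : 'I_d) :
  i != k -> tnth (mix x y k) i = tnth (mix x y k.+1) i.
Proof.
move=> ik; have /negbTE nik : (i : nat) != k by [].
by rewrite !tnth_mktuple ltnS [in RHS]leq_eqVlt nik.
Qed.

Lemma tnth_mixl d (x y : d.-tuple (measurableTypeR R)) (k : 'I_d) :
  tnth (mix x y k) k = tnth x k.
Proof. by rewrite tnth_mktuple ltnn. Qed.

Lemma tnth_mixr d (x y : d.-tuple (measurableTypeR R)) (k : 'I_d) :
  tnth (mix x y k.+1) k = tnth y k.
Proof. by rewrite tnth_mktuple leqnn. Qed.

Lemma F_mon_le d (f : d.-tuple (measurableTypeR R) -> R)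
    (x y : d.-tuple (measurableTypeR R)) :
  F_mon f -> cube x -> cube y -> (forall i, tnth x i <= tnth y i) -> f x <= f y.
Proof.
move=> [_ mf] cx cy xy.
suff H k : (k <= d)%N -> f (mix x y 0) <= f (mix x y k).
  by have := H d (leqnn d); rewrite mix0 mix_size.
elim: k => // k IH kd; apply: le_trans (IH (ltnW kd)) _.
apply: (mf (Ordinal kd)); [exact: mix_cube | exact: mix_cube | |].
- by move=> j jk; exact: (@tnth_mix_eq _ x y (Ordinal kd)).
- by rewrite (tnth_mixl x y (Ordinal kd)) (tnth_mixr x y (Ordinal kd)).
Qed.

Definition cell n d (x : d.-tuple (measurableTypeR R)) : d.-tuple nat :=
  [tuple Num.truncn (n.+1%:R * tnth x i) | i < d].

(** The truncation at 1 keeps the corners of all cells in the cube, also for points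
    outside of it.  In a coordinate that is at least 1 both corners are 1, so only
    the [n.+1] cells of the unit interval contribute to an oscillation. *)
Definition node n (k : nat) : R := Num.min 1 (k%:R / n.+1%:R).

Definition lower_corner n d (x : d.-tuple (measurableTypeR R)) :
    d.-tuple (measurableTypeR R) :=
  [tuple node n (tnth (cell n x) i) | i < d].

Definition upper_corner n d (x : d.-tuple (measurableTypeR R)) :
    d.-tuple (measurableTypeR R) :=
  [tuple node n (tnth (cell n x) i).+1 | i < d].

Lemma node_itv n k : 0 <= node n k <= 1.
Proof. by rewrite /node le_min ler01 divr_ge0//= ge_min lexx. Qed.

Lemma le_node n k l : (k <= l)%N -> node n k <= node n l.
Proof.
move=> kl; rewrite /node le_min ge_min lexx/= ge_min; apply/orP; right.
by rewrite ler_pM2r ?invr_gt0// ler_nat.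
Qed.

Lemma node_sat n k : (n < k)%N -> node n k = 1.
Proof. by move=> nk; apply: min_l; rewrite ler_pdivlMr// mul1r ler_nat. Qed.

Lemma node_unsat n k : (k <= n)%N -> node n k = k%:R / n.+1%:R.
Proof.
by move=> kn; apply: min_r; rewrite ler_pdivrMr// mul1r ler_nat (leq_trans kn).
Qed.

Lemma node_truncn n (y : R) : 0 <= y <= 1 ->
  node n (Num.truncn (n.+1%:R * y)) <= y <= node n (Num.truncn (n.+1%:R * y)).+1.
Proof.
move=> /andP[y0 y1].
have /truncn_itv/andP[t1 t2] : 0 <= n.+1%:R * y by rewrite mulr_ge0.
rewrite /node ge_min le_min y1/= ler_pdivrMr// ler_pdivlMr// ![y * _]mulrC.
by rewrite t1 (ltW t2) orbT.
Qed.

Lemma lower_corner_cube n d (x : d.-tuple (measurableTypeR R)) :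
  cube (lower_corner n x).
Proof. by move=> i; rewrite tnth_mktuple node_itv. Qed.

Lemma upper_corner_cube n d (x : d.-tuple (measurableTypeR R)) :
  cube (upper_corner n x).
Proof. by move=> i; rewrite tnth_mktuple node_itv. Qed.

Lemma lower_corner_le n d (x : d.-tuple (measurableTypeR R)) i :
  cube x -> tnth (lower_corner n x) i <= tnth x i.
Proof.
by move=> /(_ i)/(node_truncn n)/andP[+ _]; rewrite 2!tnth_mktuple.
Qed.

Lemma upper_corner_ge n d (x : d.-tuple (measurableTypeR R)) i :
  cube x -> tnth x i <= tnth (upper_corner n x) i.
Proof.
by move=> /(_ i)/(node_truncn n)/andP[_ +]; rewrite 2!tnth_mktuple.
Qed.

Lemma measurable_truncn n k :
  measurable [set y : measurableTypeR R | Num.truncn (n.+1%:R * y) = k].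
Proof.
have mS (z : int) :
    measurable [set y : measurableTypeR R | Num.floor (n.+1%:R * y) = z].
  rewrite (_ : [set _ | _] = [set` `[z%:~R / n.+1%:R, (z + 1)%:~R / n.+1%:R[]).
    exact: measurable_itv.
  apply/seteqP; split => y /=; rewrite in_itv/= ler_pdivrMr// ltr_pdivlMr//.
    by move=> /eqP; rewrite floor_eq [y * _]mulrC.
  by rewrite [y * _]mulrC -floor_eq => /eqP.
rewrite (_ : [set _ | _] = \bigcup_(z in [set z | (if z is Posz m then m else 0%N) = k])
    [set y : measurableTypeR R | Num.floor (n.+1%:R * y) = z]).
  rewrite bigcup_mkcond; apply: countable_bigcupT_measurable => // z.
  by case: ifP => _; [exact: mS | exact: measurable0].
apply/seteqP; split => y /=.
  by rewrite truncEfloor => yk; exists (Num.floor (n.+1%:R * y)).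
by rewrite truncEfloor => -[z /= zk ->].
Qed.

(** The cells form a countable partition of the space into Borel sets. *)
Lemma measurable_cell n d (S : set (d.-tuple nat)) :
  measurable [set x : d.-tuple (measurableTypeR R) | S (cell n x)].
Proof.
rewrite (_ : [set _ | _] = \bigcup_(k in S) \bigcap_(i in [set: 'I_d])
    [set x : d.-tuple (measurableTypeR R) |
      Num.truncn (n.+1%:R * tnth x i) = tnth k i]).
  rewrite bigcup_mkcond; apply: countable_bigcupT_measurable => // k.
  case: ifP => _; last exact: measurable0.
  apply: fin_bigcap_measurable => // i _.
  have := @measurable_tnth _ (measurableTypeR R) d i measurableT _
    (measurable_truncn n (tnth k i)).
  by rewrite setTI.
apply/seteqP; split => x /=.
  by move=> Sx; exists (cell n x) => // i _ /=; rewrite tnth_mktuple.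
move=> [k Sk kx]; rewrite (_ : cell n x = k)//.
by apply/eq_from_tnth => i; rewrite tnth_mktuple; exact: kx.
Qed.

Lemma measurable_fun_cell n d (F : d.-tuple nat -> R) :
  measurable_fun [set: d.-tuple (measurableTypeR R)] (fun x => F (cell n x)).
Proof. by move=> _ Y mY; rewrite setTI; exact: (measurable_cell n (F @^-1` Y)). Qed.

Lemma measurable_lower_corner n d (f : d.-tuple (measurableTypeR R) -> R) :
  measurable_fun [set: d.-tuple (measurableTypeR R)] (fun x => f (lower_corner n x)).
Proof.
exact: (measurable_fun_cell n (fun k => f [tuple node n (tnth k i) | i < d])).
Qed.

Lemma measurable_upper_corner n d (f : d.-tuple (measurableTypeR R) -> R) :
  measurable_fun [set: d.-tuple (measurableTypeR R)] (fun x => f (upper_corner n x)).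
Proof.
exact: (measurable_fun_cell n (fun k => f [tuple node n (tnth k i).+1 | i < d])).
Qed.

Lemma lebesgue01_cell n k : (k <= n)%N ->
  (@lebesgue01 R [set y | Num.truncn (n.+1%:R * y) = k] <= (n.+1%:R^-1)%:E)%E.
Proof.
move=> kn; rewrite /lebesgue01 /mrestr.
apply: (@le_trans _ _ (@lebesgue_measure R `[k%:R / n.+1%:R, k.+1%:R / n.+1%:R])).
  apply: le_measure; rewrite ?inE.
  - by apply: measurableI; [exact: measurable_truncn | exact: measurable_itv].
  - exact: measurable_itv.
  - move=> y [/= yk]; rewrite !in_itv/= => y01.
    have := node_truncn n y01; rewrite yk /node ge_min le_min.
    move=> /andP[+ /andP[_ ->]]; rewrite andbT.
    move=> /orP[|//] y1; move: y01 => /andP[_ yl1].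
    have -> : y = 1 by apply/eqP; rewrite eq_le yl1 y1.
    by rewrite ler_pdivrMr// mul1r ler_nat ltnW.
rewrite lebesgue_measure_itv/= lte_fin ltr_pM2r ?invr_gt0// ltr_nat leqnn.
by rewrite -EFinB -mulrBl lee_fin -natrB ?leqnSn// subSnn mul1r.
Qed.

(** Each of the [n.+1] cells of the unit interval has length [n.+1%:R^-1], so the
    integral is a telescoping sum divided by [n.+1]. *)
Lemma integral_oscillation1 n (u : nat -> R) :
  u 0%N >= 0 -> u n.+1 <= 1 ->
  (forall k, u k <= u k.+1) -> (forall k, (n < k)%N -> u k.+1 = u k) ->
  (\int[@lebesgue01 R]_y (u (Num.truncn (n.+1%:R * y)).+1 -
     u (Num.truncn (n.+1%:R * y)))%:E <= (n.+1%:R^-1)%:E)%E.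
Proof.
move=> u0 u1 ndu usat.
pose I k : set (measurableTypeR R) := [set y | Num.truncn (n.+1%:R * y) = k].
under eq_integral => y _.
  rewrite (_ : _%:E =
    (\sum_(k < n.+1) ((u k.+1 - u k)%:E * (\1_(I k) y)%:E))%E); last first.
    have [ky|ky] := leqP (Num.truncn (n.+1%:R * y)) n.
      rewrite (bigD1 (Ordinal (ky : (_ < n.+1)%N)))//= indicE mem_set// mule1.
      rewrite big1 ?adde0// => k kk; rewrite indicE memNset ?mule0//.
      by move=> /= e; move: kk; rewrite -val_eqE/= e eqxx.
    rewrite usat// subrr big1// => k _; rewrite indicE memNset ?mule0//.
    by move=> /= e; move: ky; rewrite e ltnNge -ltnS ltn_ord.
  over.
have mI k : measurable (I k) by exact: measurable_truncn.
have du k : 0 <= u k.+1 - u k by rewrite subr_ge0.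
rewrite ge0_integral_sum//=; last 2 first.
- move=> k; apply: measurable_funeM; apply/measurable_EFinP.
  exact: measurable_indic.
- by move=> k y _; rewrite mule_ge0// lee_fin.
apply: (@le_trans _ _ (\sum_(k < n.+1) ((u k.+1 - u k) / n.+1%:R)%:E)%E).
  apply: lee_sum => k _; rewrite ge0_integralZl_EFin//; last first.
    by apply/measurable_EFinP; exact: measurable_indic.
  rewrite EFinM lee_wpmul2l ?lee_fin// integral_indic// setIT.
  by apply: lebesgue01_cell; rewrite -ltnS.
rewrite sumEFin lee_fin -mulr_suml -(big_mkord xpredT (fun k => u k.+1 - u k)).
rewrite telescope_sumr// ler_piMl ?invr_ge0//; lra.
Qed.

Lemma cell_cons n d (a : measurableTypeR R) (x : d.-tuple (measurableTypeR R)) :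
  cell n (cons_point (a, x)) = [tuple of Num.truncn (n.+1%:R * a) :: cell n x].
Proof.
apply/eq_from_tnth => i; rewrite tnth_mktuple.
case: (unliftP ord0 i) => [j|] ->; first by rewrite !tnthS tnth_mktuple.
by rewrite !tnth0.
Qed.

Lemma lower_corner_cons n d (a : measurableTypeR R)
    (x : d.-tuple (measurableTypeR R)) :
  lower_corner n (cons_point (a, x)) =
  cons_point (node n (Num.truncn (n.+1%:R * a)) : measurableTypeR R,
              lower_corner n x).
Proof.
apply/eq_from_tnth => i; rewrite tnth_mktuple cell_cons.
case: (unliftP ord0 i) => [j|] ->; first by rewrite !tnthS [RHS]tnth_mktuple.
by rewrite !tnth0.
Qed.

Lemma upper_corner_cons n d (a : measurableTypeR R)
    (x : d.-tuple (measurableTypeR R)) :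
  upper_corner n (cons_point (a, x)) =
  cons_point (node n (Num.truncn (n.+1%:R * a)).+1 : measurableTypeR R,
              upper_corner n x).
Proof.
apply/eq_from_tnth => i; rewrite tnth_mktuple cell_cons.
case: (unliftP ord0 i) => [j|] ->; first by rewrite !tnthS [RHS]tnth_mktuple.
by rewrite !tnth0.
Qed.

Lemma cons_point_cube d (a : measurableTypeR R) (x : d.-tuple (measurableTypeR R)) :
  0 <= a <= 1 -> cube x -> cube (cons_point (a, x)).
Proof.
by move=> a01 cx i; case: (unliftP ord0 i) => [j|] ->; rewrite ?tnthS ?tnth0//.
Qed.

Lemma F_mon_cons d (f : d.+1.-tuple (measurableTypeR R) -> R)
    (a : measurableTypeR R) :
  F_mon f -> 0 <= a <= 1 -> F_mon (fun x => f (cons_point (a, x))).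
Proof.
move=> [uf mf] a01; split => [x cx|i x y cx cy xy xyi].
  by apply: uf; exact: cons_point_cube.
apply: (mf (lift ord0 i)); [exact: cons_point_cube..| |].
- move=> j; case: (unliftP ord0 j) => [k|] ->; last by rewrite !tnth0.
  by rewrite !tnthS => ki; apply: xy; apply: contraNneq ki => ->.
- by rewrite !tnthS.
Qed.

Lemma le_lower_upper_corner n d (x : d.-tuple (measurableTypeR R)) i :
  tnth (lower_corner n x) i <= tnth (upper_corner n x) i.
Proof. by rewrite !tnth_mktuple le_node. Qed.

(** Induction on the dimension.  The corner [c n x], lower in the first
    coordinate and upper in the others, splits the difference in two: the change
    in the first coordinate is handled by the one-dimensional telescoping sum for
    fixed other coordinates, the remaining change by the induction hypothesis for
    a fixed first coordinate, so the integrals are iterated in opposite orders. *)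
Lemma integral_oscillation n d (f : d.-tuple (measurableTypeR R) -> R) : F_mon f ->
  (\int[borel_cube R d]_x (f (upper_corner n x) - f (lower_corner n x))%:E <=
   (d%:R / n.+1%:R)%:E)%E.
Proof.
elim: d f => [|d IH] f Ff.
  rewrite mul0r (eq_integral (cst 0%E)) ?integral0// => x _.
  by rewrite [upper_corner n x]tuple0 [lower_corner n x]tuple0 subrr.
pose c n := fun x : d.+1.-tuple (measurableTypeR R) =>
  cons_point (node n (head 0%N (cell n x)) : measurableTypeR R,
    [tuple node n (tnth (cell n x) (lift ord0 i)).+1 | i < d]).
have cE a (x : d.-tuple (measurableTypeR R)) : c n (cons_point (a, x)) =
    cons_point (node n (Num.truncn (n.+1%:R * a)) : measurableTypeR R,
                upper_corner n x).
  congr (cons_point (_, _)); first by rewrite cell_cons.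
  by apply/eq_from_tnth => i; rewrite !tnth_mktuple tnthS.
have mc : measurable_fun [set: d.+1.-tuple (measurableTypeR R)] (fun x => f (c n x)).
  exact: (measurable_fun_cell n (fun k : d.+1.-tuple nat =>
   f (cons_point (node n (head 0%N k) : measurableTypeR R,
       [tuple node n (tnth k (lift ord0 i)).+1 | i < d])))).
have ml := measurable_lower_corner n f.
have mu := measurable_upper_corner n f.
have cc x : cube (c n x).
  by apply: cons_point_cube; [exact: node_itv | move=> i; rewrite tnth_mktuple node_itv].
have lc x : f (lower_corner n x) <= f (c n x).
  apply: (F_mon_le Ff) => //; first exact: lower_corner_cube.
  move=> i; rewrite tnth_mktuple /c; case: (unliftP ord0 i) => [j|] ->.
    by rewrite tnthS [leRHS]tnth_mktuple le_node.
  by rewrite !tnth0 !(tnth_nth 0%N) nth0.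
have cu x : f (c n x) <= f (upper_corner n x).
  apply: (F_mon_le Ff) => //; first exact: upper_corner_cube.
  move=> i; rewrite [leRHS]tnth_mktuple /c; case: (unliftP ord0 i) => [j|] ->.
    by rewrite tnthS [leLHS]tnth_mktuple.
  by rewrite !tnth0 !(tnth_nth 0%N) nth0 le_node.
under eq_integral => x _.
  rewrite (_ : _ - _ = (f (upper_corner n x) - f (c n x)) +
                       (f (c n x) - f (lower_corner n x))); last by rewrite addrA subrK.
  rewrite EFinD; over.
rewrite ge0_integralD//; last 4 first.
- by move=> x _; rewrite lee_fin subr_ge0.
- by apply/measurable_EFinP; exact: measurable_funB.
- by move=> x _; rewrite lee_fin subr_ge0.
- by apply/measurable_EFinP; exact: measurable_funB.
rewrite -natr1 [d%:R + 1]addrC mulrDl EFinD mul1r; apply: leeD.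
  rewrite ge0_integral_borel_cubeS_swap; last 2 first.
  - by apply/measurable_EFinP; exact: measurable_funB.
  - by move=> x; rewrite lee_fin subr_ge0.
  apply: (@le_trans _ _ (\int[borel_cube R d]_x (cst (n.+1%:R^-1)%:E x))%E); last first.
    by rewrite (integral_prob_cst (borel_cube R d)).
  have H : measurable_fun [set: d.+1.-tuple (measurableTypeR R)]
     (fun x => (f (upper_corner n x) - f (c n x))%:E).
    by apply/measurable_EFinP; exact: measurable_funB.
  apply: ge0_le_integral => //.
  - by move=> x _; apply: integral_ge0 => a _; rewrite lee_fin subr_ge0.
  - apply: (measurable_fun_fubini_tonelli_G
      (fun z => (f (upper_corner n (cons_point z)) - f (c n (cons_point z)))%:E)).
    + exact: (measurableT_comp H (@measurable_cons_point R d)).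
    + by move=> z; rewrite lee_fin subr_ge0.
  - move=> x _; under eq_integral do rewrite upper_corner_cons cE.
    pose u k := f (cons_point (node n k : measurableTypeR R, upper_corner n x)).
    have uc k : cube (cons_point (node n k : measurableTypeR R, upper_corner n x)).
      by apply: cons_point_cube; [exact: node_itv | exact: upper_corner_cube].
    apply: (@integral_oscillation1 n u).
    + by have /andP[] := Ff.1 _ (uc 0%N).
    + by have /andP[] := Ff.1 _ (uc n.+1).
    + move=> k; apply: (F_mon_le Ff) => // i.
      case: (unliftP ord0 i) => [j|] ->; first by rewrite !tnthS.
      by rewrite !tnth0 le_node.
    + by move=> k nk; rewrite /u !node_sat// (ltn_trans nk).
rewrite ge0_integral_borel_cubeS; last 2 first.
- by apply/measurable_EFinP; exact: measurable_funB.
- by move=> x; rewrite lee_fin subr_ge0.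
apply: (@le_trans _ _ (\int[@lebesgue01 R]_x (cst (d%:R / n.+1%:R)%:E x))%E); last first.
  by rewrite (integral_prob_cst (@lebesgue01 R)).
have H : measurable_fun [set: d.+1.-tuple (measurableTypeR R)]
   (fun x => (f (c n x) - f (lower_corner n x))%:E).
  by apply/measurable_EFinP; exact: measurable_funB.
apply: ge0_le_integral => //.
- by move=> x _; apply: integral_ge0 => a _; rewrite lee_fin subr_ge0.
- apply: (measurable_fun_fubini_tonelli_F
    (fun z => (f (c n (cons_point z)) - f (lower_corner n (cons_point z)))%:E)).
  + exact: (measurableT_comp H (@measurable_cons_point R d)).
  + by move=> z; rewrite lee_fin subr_ge0.
- move=> a _; under eq_integral do rewrite lower_corner_cons cE.
  apply: (IH (fun x => f (cons_point (node n (Num.truncn (n.+1%:R * a))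
     : measurableTypeR R, x)))).
  by apply: F_mon_cons => //; exact: node_itv.
Qed.

End grid.

(** * The completed measure and measurability of the two classes *)

Section completion.
Variables (R : realType) (d : nat).
Implicit Types f h : d.-tuple (measurableTypeR R) -> R.
Local Open Scope ereal_scope.

Lemma measure_bigsetU_le d' (T : measurableType d') (mu : {measure set T -> \bar R})
    I (r : seq I) (P : pred I) (F : I -> set T) :
  (forall i, measurable (F i)) ->
  mu (\big[setU/set0]_(i <- r | P i) F i) <= \sum_(i <- r | P i) mu (F i).
Proof.
move=> mF; elim: r => [|i r IH]; first by rewrite !big_nil measure0.
rewrite !big_cons; case: ifP => // _.
apply: le_trans (leeD2l _ IH); apply: measureU2 => //.
exact: bigsetU_measurable.
Qed.

Lemma measurable_open_cube : measurable (@open_cube R d).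
Proof.
rewrite -[X in measurable X]setCK setC_open_cube; apply: measurableC.
apply: bigsetU_measurable => i _; rewrite -[X in measurable X]setTI.
apply: (@measurable_tnth _ (measurableTypeR R) d i) => //.
by apply: measurableC; exact: measurable_itv.
Qed.

Lemma borel_cube_setC_open_cube : borel_cube R d (~` @open_cube R d) = 0.
Proof.
have mE : measurable (~` `]0%R, 1%R[ : set (measurableTypeR R)).
  by apply: measurableC; exact: measurable_itv.
apply/eqP; rewrite eq_le measure_ge0 andbT setC_open_cube.
apply: le_trans (measure_bigsetU_le _ _ _ _) _.
  move=> i; rewrite -[X in measurable X]setTI.
  exact: (@measurable_tnth _ (measurableTypeR R) d i).
rewrite big1// => i _; apply: borel_cube_coordinate0 => //.
rewrite /lebesgue01 /mrestr (_ : _ `&` _ = [set 0%R; 1%R]).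
  by apply: countable_lebesgue_measure0; exact: finite_set_countable.
apply/seteqP; split => x /=; rewrite !in_itv/=.
  move=> [/negP]; rewrite negb_and -!leNgt => /orP[x0|x1] /andP[x0' x1'].
  - by left; apply/eqP; rewrite eq_le x0.
  - by right; apply/eqP; rewrite eq_le x1'.
by move=> [->|->]; rewrite ?ltxx ?lexx ?ler01 ?andbF; split.
Qed.

Lemma measurable_cube_type (A : set (d.-tuple (measurableTypeR R))) :
  measurable A -> measurable (A : set (cube_type R d)).
Proof. exact: caratheodory_measurable_mu_ext. Qed.

Lemma lebesgue_cubeE (A : set (d.-tuple (measurableTypeR R))) :
  measurable A -> lebesgue_cube R d A = borel_cube R d A.
Proof. exact: measurable_mu_extE. Qed.

Lemma lebesgue_cube_complete : measure_is_complete (lebesgue_cube R d).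
Proof. exact: measure_is_complete_caratheodory. Qed.

Lemma lebesgue_cube_setT : lebesgue_cube R d setT = 1.
Proof. by rewrite lebesgue_cubeE//; exact: probability_setT. Qed.

Lemma lebesgue_cube_setC_open_cube : lebesgue_cube R d (~` @open_cube R d) = 0.
Proof.
rewrite lebesgue_cubeE ?borel_cube_setC_open_cube//.
by apply: measurableC; exact: measurable_open_cube.
Qed.

Lemma measurable_cube : measurable (@cube R d : set (cube_type R d)).
Proof.
rewrite -[X in measurable X]setCK; apply: measurableC.
suff : (lebesgue_cube R d).-negligible (~` @cube R d) by exact: lebesgue_cube_complete.
exists (~` @open_cube R d); split.
- by apply: measurable_cube_type; apply: measurableC; exact: measurable_open_cube.
- exact: lebesgue_cube_setC_open_cube.
- by apply: subsetC; exact: open_cubeW.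
Qed.

Lemma lebesgue_cube_cube : lebesgue_cube R d (@cube R d) = 1.
Proof.
apply/eqP; rewrite eq_le; apply/andP; split.
  rewrite -lebesgue_cube_setT; apply: le_measure; rewrite ?inE//.
  exact: measurable_cube.
rewrite -lebesgue_cube_setT -(setUv (@open_cube R d)).
have mo := measurable_open_cube.
apply: (@le_trans _ _ (lebesgue_cube R d (@open_cube R d) +
                       lebesgue_cube R d (~` @open_cube R d))).
  apply: measureU2; first exact: measurable_cube_type.
  exact/measurable_cube_type/measurableC.
rewrite lebesgue_cube_setC_open_cube adde0; apply: le_measure; rewrite ?inE.
- exact: measurable_cube_type.
- exact: measurable_cube.
- exact: open_cubeW.
Qed.

(** This is where the completeness of the measure enters: only values on a Borel
    null set separate [f] from a Borel function. *)
Lemma measurable_fun_cube_type f (h : d.-tuple (measurableTypeR R) -> R) N :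
  measurable N -> borel_cube R d N = 0 ->
  measurable_fun [set: d.-tuple (measurableTypeR R)] h ->
  (forall x, ~ N x -> f x = h x) ->
  measurable_fun [set: cube_type R d] (f : cube_type R d -> R).
Proof.
move=> mN N0 mh fh; apply/measurable_EFinP.
apply: (@ae_measurable_fun _ _ _ _ lebesgue_cube_complete _ (EFin \o h)).
  exists N; split; first exact: measurable_cube_type.
    by rewrite -N0; exact: lebesgue_cubeE.
  move=> x /= H; apply: contrapT => Nx; apply: H => _ /=.
  by rewrite fh.
apply/measurable_EFinP => _ Y mY; rewrite setTI.
by apply: measurable_cube_type; rewrite -[X in measurable X]setTI; exact: mh.
Qed.

(** The supremum [l] of the lower and the infimum [u] of the upper step functions
    are Borel functions with [l <= f <= u] on the cube, and the integral of [u - l]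
    is at most [d / n] for every [n], hence zero. *)
Lemma F_mon_measurable f : F_mon f ->
  measurable_fun [set: cube_type R d] (f : cube_type R d -> R).
Proof.
move=> Ff.
pose lo n x := f (lower_corner n x); pose up n x := f (upper_corner n x).
have lo01 n x : (0 <= lo n x <= 1)%R by apply: Ff.1; exact: lower_corner_cube.
have up01 n x : (0 <= up n x <= 1)%R by apply: Ff.1; exact: upper_corner_cube.
have lo_ub x : has_ubound (range (lo ^~ x)).
  by exists 1%R => _ [n _ <-]; have /andP[] := lo01 n x.
have up_lb x : has_lbound (range (up ^~ x)).
  by exists 0%R => _ [n _ <-]; have /andP[] := up01 n x.
pose l x := sups (lo ^~ x) 0%N; pose u x := infs (up ^~ x) 0%N.
have ml : measurable_fun [set: d.-tuple (measurableTypeR R)] l.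
  apply: measurable_fun_sups => [t _|n]; first exact: lo_ub.
  exact: measurable_lower_corner.
have mu : measurable_fun [set: d.-tuple (measurableTypeR R)] u.
  apply: measurable_fun_infs => [t _|n]; first exact: up_lb.
  exact: measurable_upper_corner.
have lol n x : (lo n x <= l x)%R.
  by apply: ub_le_sup; [exact: has_ubound_sdrop | exists n].
have uup n x : (u x <= up n x)%R.
  by apply: ge_inf; [exact: has_lbound_sdrop | exists n].
have lf x : cube x -> (l x <= f x)%R.
  move=> cx; apply: ge_sup; first by exists (lo 0%N x); exists 0%N.
  move=> _ [n _ <-]; apply: (F_mon_le Ff) => //; first exact: lower_corner_cube.
  by move=> i; exact: lower_corner_le.
have fu x : cube x -> (f x <= u x)%R.
  move=> cx; apply: lb_le_inf; first by exists (up 0%N x); exists 0%N.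
  move=> _ [n _ <-]; apply: (F_mon_le Ff) => //; first exact: upper_corner_cube.
  by move=> i; exact: upper_corner_ge.
have mlu : measurable_fun [set: d.-tuple (measurableTypeR R)] (fun x => u x - l x)%R.
  exact: measurable_funB.
have mo := measurable_open_cube.
have /(ae_eq_integral_abs _ mo) : \int[borel_cube R d]_(x in @open_cube R d)
    `|(u x - l x)%:E| = 0.
  have le n : \int[borel_cube R d]_(x in @open_cube R d) `|(u x - l x)%:E| <=
      (d%:R * n.+1%:R^-1)%:E.
    apply: le_trans (integral_oscillation n Ff).
    have mul : measurable_fun [set: d.-tuple (measurableTypeR R)]
        (fun x => (up n x - lo n x)%:E).
      apply/measurable_EFinP; apply: measurable_funB.
        exact: measurable_upper_corner.
      exact: measurable_lower_corner.
    have lu0 x : (lo n x <= up n x)%R.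
      apply: (F_mon_le Ff); [exact: lower_corner_cube|exact: upper_corner_cube|].
      by move=> i; exact: le_lower_upper_corner.
    apply: (@le_trans _ _ (\int[borel_cube R d]_(x in @open_cube R d)
        (up n x - lo n x)%:E)).
      apply: ge0_le_integral => //.
      - apply: (@measurable_funS _ _ _ _ setT) => //.
        by apply: measurableT_comp => //; exact/measurable_EFinP.
      - exact: (measurable_funS _ _ mul).
      - move=> x /open_cubeW cx; rewrite abse_EFin lee_fin ger0_norm.
          by rewrite lerB.
        by rewrite subr_ge0 (le_trans (lf _ cx))// fu.
    by apply: ge0_subset_integral => // x _; rewrite lee_fin subr_ge0.
  apply/eqP; rewrite eq_le; apply/andP; split; last by apply: integral_ge0.
  apply/lee_addgt0Pr => e e0; rewrite add0e.
  have [n _ /(_ n (leqnn n)) ne] := near_infty_natSinv_lt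
     (PosNum (divr_gt0 e0 (ltr0Sn R d))).
  apply: le_trans (le n) _; rewrite lee_fin.
  apply: (@le_trans _ _ (d.+1%:R * (e / d.+1%:R)))%R; last by rewrite mulrC divfK.
  by rewrite ler_pM// ?ler_nat// ltW.
move=> /(_ _)[|N [mN N0 uN]].
  by apply/measurable_EFinP; exact: (measurable_funS _ _ mlu).
apply: (@measurable_fun_cube_type _ l (N `|` ~` @open_cube R d)) => //.
- by apply: measurableU => //; exact: measurableC.
- have : borel_cube R d (N `|` ~` @open_cube R d) <=
      borel_cube R d N + borel_cube R d (~` @open_cube R d).
    by apply: measureU2 => //; exact: measurableC.
  rewrite (_ : borel_cube R d N = 0)// borel_cube_setC_open_cube adde0 => le0.
  by apply/eqP; rewrite eq_le le0 measure_ge0.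
move=> x /not_orP[Nx /contrapT ox].
have ul : (u x - l x = 0)%R.
  apply: contrapT => ul; apply: Nx; apply: uN => /= /(_ ox)[]; exact: ul.
apply/eqP; rewrite eq_le lf ?andbT; last exact: open_cubeW.
by rewrite (le_trans (fu _ (open_cubeW ox)))// -subr_le0 ul.
Qed.

End completion.

Section convex_continuity.
Variables (R : realType) (d : nat).
Implicit Types (f : d.-tuple (measurableTypeR R) -> R)
  (x y : d.-tuple (measurableTypeR R)).

(** The point [y] lies on the segment from [x] to the point [z] of the face of the
    cube in the direction of [y], and [f z] exceeds [f x] by at most 1, so the
    increment is at most the ratio in which [y] divides this segment.  The length
    of the segment is at least [e]. *)
Lemma F_con_step f x y (i : 'I_d) (e : R) : F_con f -> cube x -> cube y ->
  (forall j, j != i -> tnth x j = tnth y j) ->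
  0 < e -> e <= tnth x i <= 1 - e ->
  f y - f x <= `|tnth y i - tnth x i| / e.
Proof.
move=> [uf cf] cx cy xy e0 /andP[ex x1e].
pose z (b : R) : d.-tuple (measurableTypeR R) :=
  [tuple if j == i then b else tnth x j | j < d].
have cz b : 0 <= b <= 1 -> cube (z b).
  by move=> b01 j; rewrite tnth_mktuple; case: ifP.
have key b t : 0 <= b <= 1 -> 0 <= t <= 1 ->
    tnth y i = t * b + (1 - t) * tnth x i -> f y - f x <= t.
  move=> b01 t01 yE.
  have -> : y = segment_point t (z b) x.
    apply/eq_from_tnth => j; rewrite !tnth_mktuple.
    by case: eqVneq => [->//|ji]; rewrite -xy//; ring.
  have := cf t _ _ t01 (cz _ b01) cx.
  have /andP[_ fz1] := uf _ (cz _ b01); have /andP[fx0 _] := uf _ cx.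
  move: t01 => /andP[t0 t1] H.
  have : t * f (z b) <= t by rewrite ler_piMr.
  have : 0 <= t * f x by rewrite mulr_ge0.
  lra.
have /andP[y0 y1] := cy i.
have [xly|ylx] := leP (tnth x i) (tnth y i).
  have e1 : e <= 1 - tnth x i by lra.
  have p0 : 0 < 1 - tnth x i by lra.
  apply: (@le_trans _ _ ((tnth y i - tnth x i) / (1 - tnth x i))).
    apply: (key 1); first by rewrite ler01 lexx.
      by rewrite divr_ge0 ?ler_pdivrMr//=; lra.
    by field; lra.
  rewrite ger0_norm; last lra.
  by rewrite ler_wpM2l ?lef_pV2 ?posrE//; lra.
have p0 : 0 < tnth x i by lra.
apply: (@le_trans _ _ ((tnth x i - tnth y i) / tnth x i)).
  apply: (key 0); first by rewrite ler01 lexx.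
    by rewrite divr_ge0 ?ler_pdivrMr//=; lra.
  by field; lra.
rewrite ltr0_norm; last lra.
by rewrite opprB ler_wpM2l ?lef_pV2 ?posrE//; lra.
Qed.

Lemma F_con_lipschitz f x y (e r : R) : F_con f ->
  0 < e -> (forall i, e <= tnth x i <= 1 - e) ->
  (forall i, e <= tnth y i <= 1 - e) ->
  (forall i, `|tnth y i - tnth x i| <= r) ->
  f y - f x <= d%:R * (r / e).
Proof.
move=> Ff e0 xe ye xyr.
have cE (z : d.-tuple (measurableTypeR R)) :
    (forall i, e <= tnth z i <= 1 - e) -> cube z.
  by move=> ze i; have /andP[] := ze i; lra.
have cx := cE _ xe; have cy := cE _ ye.
suff H k : (k <= d)%N -> f (mix x y k) - f x <= k%:R * (r / e).
  by have := H d (leqnn d); rewrite mix_size.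
elim: k => [|k IH] kd; first by rewrite mix0 subrr mul0r.
rewrite -natr1 mulrDl mul1r -(subrK (f (mix x y k)) (f (mix x y k.+1))) -addrA addrC.
apply: lerD; first exact: IH (ltnW kd).
pose i := Ordinal kd.
apply: (@le_trans _ _ (`|tnth (mix x y k.+1) i - tnth (mix x y k) i| / e)).
  apply: F_con_step => //; [exact: mix_cube|exact: mix_cube| |].
  - by move=> j jk; exact: (@tnth_mix_eq _ _ x y i).
  - by rewrite (tnth_mixl x y i).
by rewrite (tnth_mixl x y i) (tnth_mixr x y i) ler_wpM2r ?invr_ge0 ?(ltW e0).
Qed.

Lemma node_step n k : node R n k.+1 - node R n k <= n.+1%:R^-1.
Proof.
have [nk|kn] := ltnP n k.
  by rewrite (node_sat R nk) (node_sat R (leqW nk)) subrr invr_ge0.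
rewrite (node_unsat R kn) lerBlDr.
have -> : n.+1%:R^-1 + k%:R / n.+1%:R = k.+1%:R / n.+1%:R :> R.
  by rewrite -[k.+1%:R]nat1r mulrDl mul1r.
by rewrite /node ge_min lexx orbT.
Qed.

Let shrink (e h a b : R) : e <= a <= 1 - e -> 0 <= a - b <= h -> h < e / 2 ->
  [/\ e / 2 <= a <= 1 - e / 2, e / 2 <= b <= 1 - e / 2,
      `|a - b| <= h & `|b - a| <= h].
Proof.
move=> ea abh he; rewrite [`|b - a|]distrC !ler_norml.
by split; try (apply/andP; split); lra.
Qed.

Lemma F_con_cvg f x : F_con f -> open_cube x ->
  (fun n => f (lower_corner n x)) @ \oo --> f x.
Proof.
move=> Ff ox.
have [e e0 xe] : exists2 e : R, 0 < e & forall i, e <= tnth x i <= 1 - e.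
  pose m i : R := Num.min (tnth x i) (1 - tnth x i).
  exists (\big[Num.min/1]_(i < d) m i).
    elim/big_ind : _ => // [a b a0 b0|i _]; first by rewrite lt_min a0.
    by rewrite lt_min; have := ox i; lra.
  move=> i; have : \big[Num.min/1]_(i < d) m i <= m i by exact: bigmin_le.
  by rewrite le_min; lra.
(* The corner may be closer to the boundary than [x], but for a fine grid at
   least half as far. *)
pose e2 : R := e / 2.
have e20 : 0 < e2 by rewrite divr_gt0.
apply/cvgrPdist_le => r r0.
have r1 : 0 < r * e2 / d.+1%:R by rewrite divr_gt0// mulr_gt0.
near=> n.
have n1 : n.+1%:R^-1 < e2 by near: n; exact: (near_infty_natSinv_lt (PosNum e20)).
have n2 : n.+1%:R^-1 < r * e2 / d.+1%:R.
  by near: n; exact: (near_infty_natSinv_lt (PosNum r1)).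
have n0 : 0 < n.+1%:R^-1 :> R by rewrite invr_gt0.
have lx i : 0 <= (tnth x i - tnth (lower_corner n x) i : R) <= n.+1%:R^-1.
  rewrite subr_ge0 lower_corner_le/=; last exact: open_cubeW.
  rewrite lerBlDl; apply: (le_trans (upper_corner_ge n i (open_cubeW ox))).
  by rewrite [tnth (upper_corner _ _) _]tnth_mktuple
    [tnth (lower_corner _ _) _]tnth_mktuple -lerBlDl node_step.
have bound : d%:R * (n.+1%:R^-1 / e2) <= r.
  apply: (@le_trans _ _ (d.+1%:R * (r * e2 / d.+1%:R / e2))).
    by rewrite ler_pM ?ler_nat ?divr_ge0 ?ler_wpM2r ?invr_ge0// ltW.
  by rewrite le_eqVlt; apply/orP; left; apply/eqP; field; rewrite gt_eqF//=.
have sh i := shrink (xe i) (lx i) n1.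
rewrite ler_norml; apply/andP; split.
  rewrite lerNl opprB; apply: le_trans bound.
  by apply: F_con_lipschitz => // i; have [] := sh i.
apply: le_trans bound.
by apply: F_con_lipschitz => // i; have [] := sh i.
Unshelve. all: by end_near. Qed.

Lemma F_con_measurable f : F_con f ->
  measurable_fun [set: cube_type R d] (f : cube_type R d -> R).
Proof.
move=> Ff; have mo := @measurable_open_cube R d.
have mf : measurable_fun (@open_cube R d) f.
  apply: (@measurable_fun_cvg _ _ _ _ (fun n x => f (lower_corner n x))) => [n|x ox].
    exact: (measurable_funS _ _ (measurable_lower_corner n f)).
  exact: F_con_cvg.
apply: (@measurable_fun_cube_type _ _ _ (f \_ (@open_cube R d)) (~` @open_cube R d)).
- exact: measurableC.
- exact: borel_cube_setC_open_cube.
- exact/(measurable_restrictT _ _).1.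
- by move=> x /contrapT ox; rewrite patchE mem_set.
Qed.

End convex_continuity.

(** * Integration is not harder than approximation *)

Section Lnorm_total_mass1.
Context (d : measure_display) (T : measurableType d) (R : realType).
Variable mu : {measure set T -> \bar R}.
Hypothesis mu1 : mu setT = 1%E.
Local Open Scope ereal_scope.

(** Hoelder's inequality against the constant 1, whose norms are all 1. *)
Lemma Lnorm1_le (p : \bar R) (h : T -> R) : 1 <= p ->
  measurable_fun setT h -> 'N[mu]_1 [EFin \o h] <= 'N[mu]_p [EFin \o h].
Proof.
move=> p1 mh.
have mabs : measurable_fun setT (fun x => `|(EFin \o h) x|).
  by apply: measurableT_comp => //; exact/measurable_EFinP.
case: p p1 => [r| |//]; last first.
  move=> _; rewrite Lnorm1 unlock mu1 lte01.
  apply: (@le_trans _ _ (\int[mu]_x (cst (ess_sup mu (abse \o (EFin \o h))) x))).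
    apply: ae_ge0_le_integral => //.
    - move=> x _; apply: ess_sup_gee; first by rewrite mu1 lte01.
      by apply: nearW => y; rewrite abse_ge0.
    - have := ess_sup_ge mu (abse \o (EFin \o h)).
      by apply: filterS => x + _.
  by rewrite integral_cst// mu1 mule1.
rewrite lee_fin le_eqVlt => /predU1P[<-//|r1].
have r0 : (0 < r)%R by exact: lt_trans r1.
have q0 : (0 < 1 - r^-1)%R by rewrite subr_gt0 invf_lt1.
have := @hoelder _ _ _ mu h (cst 1%R) r (1 - r^-1)^-1 mh (measurable_cst _) r0.
rewrite invr_gt0 q0 invrK => /(_ isT); rewrite addrC subrK => /(_ erefl).
rewrite (_ : (h \* cst 1)%R = h); last by apply/funext => x /=; rewrite mulr1.
rewrite (_ : EFin \o cst 1%R = cst 1)// Lnorm_cst1 mu1 poweR1r mule1.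
by [].
Qed.

Lemma normr_Rintegral_le_Lnorm (p : \bar R) (D : set T) (h : T -> R) : 1 <= p ->
  measurable D -> measurable_fun setT h -> mu.-integrable D (EFin \o h) ->
  (`|\int[mu]_(x in D) h x|%R)%:E <= 'N[mu]_p [EFin \o h].
Proof.
move=> p1 mD mh ih; apply: le_trans (Lnorm1_le p1 mh).
rewrite EFin_normr_Rintegral//.
apply: le_trans (le_abse_integral _ _ _) _ => //; first by case/integrableP: ih.
rewrite Lnorm1; apply: ge0_subset_integral => //.
by apply: measurableT_comp => //; exact/measurable_EFinP.
Qed.

End Lnorm_total_mass1.

Section integration_from_approximation.
Variables (R : realType) (d : nat) (p : \bar R) (p1 : (1 <= p)%E).
Local Notation mu := (lebesgue_cube R d).

Lemma unit_valued_integrable (f : d.-tuple (measurableTypeR R) -> R) :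
  unit_valued f ->
  measurable_fun [set: cube_type R d] (f : cube_type R d -> R) ->
  mu.-integrable (@cube R d) (EFin \o f).
Proof.
move=> uf mf; apply: (@le_integrable _ _ _ mu _ (@measurable_cube R d) _ (cst 1%E)).
- by apply/measurable_EFinP; exact: (measurable_funS _ _ mf).
- move=> x cx /=; rewrite normr1 lee_fin ger0_norm; by have /andP[] := uf x cx.
- apply/integrableP; split; first exact: measurable_cst.
  rewrite (eq_integral (cst 1%E)) => [|x _]; last by rewrite /= normr1.
  by rewrite integral_cst ?mul1e ?lebesgue_cube_cube ?ltry//; exact: (@measurable_cube R d).
Qed.

(** Since L_p is contained in L_1 for a finite measure, [g] is integrable, and the
    difference of the integrals is the integral of the difference. *)
Lemma dist_integral_le_Lnorm (f : d.-tuple (measurableTypeR R) -> R)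
    (g : LspaceType mu p1) : unit_valued f ->
  measurable_fun [set: cube_type R d] (f : cube_type R d -> R) ->
  ((`|INT f - \int[mu]_(x in @cube R d) g x|)%:E <=
   'N[mu]_p [EFin \o (f \- g)%R])%E.
Proof.
move=> uf mf.
have mg : measurable_fun [set: cube_type R d] (g : cube_type R d -> R).
  move=> _ Y mY.
  have := @measurable_funPT _ _ _ _ (repr (LebesgueSpace.sort g)) measurableT Y mY.
  by [].
have mfg : measurable_fun [set: cube_type R d] ((f \- g)%R : cube_type R d -> R).
  exact: measurable_funB.
have mc := @measurable_cube R d.
have intf := unit_valued_integrable uf mf.
have intg : mu.-integrable (@cube R d) (EFin \o g).
  apply: (@integrableS _ _ _ mu setT) => //.
  apply/Lfun1_integrable.
  have : (g : cube_type R d -> R) \in Lfun mu p.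
    by rewrite inE; apply/andP; split; rewrite inE//=; exact: Lebesgue_finite.
  by apply: (Lfun_subset (lexx 1%E) p1 _ p1); rewrite lebesgue_cube_setT.
have intfg : mu.-integrable (@cube R d) (EFin \o (f \- g)%R).
  by have := integrableB mc intf intg; apply: eq_integrable.
rewrite /INT -RintegralB//.
exact: (normr_Rintegral_le_Lnorm (lebesgue_cube_setT R d) p1 mc mfg intfg).
Qed.

Lemma e_int_le_e_app (F : set (d.-tuple (measurableTypeR R) -> R)) n :
  (forall f, F f -> unit_valued f) ->
  (forall f, F f -> measurable_fun [set: cube_type R d] (f : cube_type R d -> R)) ->
  (e_int F n <= e_app p1 F n)%E.
Proof.
move=> uF mF; apply: le_ereal_inf_tmp => _ [A _ <-].
pose A' : algorithm R d n R := Algorithm (@sample_cube _ _ _ _ A)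
  (fun y => \int[mu]_(x in @cube R d) output A y x).
apply: (@le_trans _ _ (ereal_sup [set (`|INT f - run A' f|)%:E | f in F])).
  by apply: ereal_inf_lbound; exists A'.
apply: ge_ereal_sup => _ [f Ff <-].
apply: le_trans (dist_integral_le_Lnorm (run A f) (uF _ Ff) (mF _ Ff)) _.
by apply: ereal_sup_ubound; exists f.
Qed.

Lemma complexity_le (e1 e2 : nat -> \bar R) (eps : R) :
  (forall n, (e1 n <= e2 n)%E) -> (complexity e1 eps <= complexity e2 eps)%E.
Proof.
move=> e12; rewrite /complexity; case: pselect => [ex1|nex1].
  case: pselect => [ex2|_]; last by rewrite leey.
  rewrite lee_fin ler_nat; case: ex_minnP => m _ mmin; case: ex_minnP => k /asboolP k2 _.
  by apply: mmin; apply/asboolP; exact: le_trans k2.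
case: pselect => [ex2|//]; exfalso; case: ex2 => k /asboolP k2; apply: nex1.
by exists k; apply/asboolP; exact: le_trans k2.
Qed.

End integration_from_approximation.

(** * Fooling functions and the curse of dimensionality *)

Section fooling.
Variables (R : realType) (d : nat).
Implicit Types (f g : d.-tuple (measurableTypeR R) -> R)
  (t : seq R -> d.-tuple (measurableTypeR R)).

(** For adaptive sampling it suffices that [g] reproduces the values of [f] at the
    points that the algorithm visits on [f]: the two runs then never diverge. *)
Lemma eq_information t f g n :
  (forall k, (k < n)%N -> g (t (information t f k)) = f (t (information t f k))) ->
  information t g n = information t f n.
Proof.
elim: n => // n IH fg /=.
have IHn : information t g n = information t f n.
  by apply: IH => k kn; apply: fg; exact: ltnW.
by apply: val_inj; rewrite /= IHn fg.
Qed.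

(** One output serves both functions, so it is at distance at least half of the
    gap from one of the two integrals. *)
Lemma e_int_ge_fooling (F : set (d.-tuple (measurableTypeR R) -> R)) n (r : R) :
  (forall t, (forall y, cube (t y)) -> exists f g,
    [/\ F f, F g, information t f n = information t g n & r <= INT g - INT f]) ->
  ((r / 2)%:E <= e_int F n)%E.
Proof.
move=> H; apply: le_ereal_inf_tmp => _ [A _ <-].
have [f [g [Ff Fg fg rfg]]] := H (sample A) (@sample_cube _ _ _ _ A).
have rfgA : run A f = run A g by rewrite /run fg.
have [fA|fA] := leP (r / 2) `|INT f - run A f|.
  apply: (@le_trans _ _ (`|INT f - run A f|)%:E); first by rewrite lee_fin.
  by apply: ereal_sup_ubound; exists f.
have : r / 2 <= `|INT g - run A g|.
  have := ler_distD (run A f) (INT g) (INT f).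
  have : r <= `|INT g - INT f| by rewrite (le_trans rfg)// ler_norm.
  by rewrite -rfgA [`|run A f - _|]distrC; move: fA; lra.
move=> gA; apply: (@le_trans _ _ (`|INT g - run A g|)%:E); first by rewrite lee_fin.
by apply: ereal_sup_ubound; exists g.
Qed.

Lemma INT_indic (A : set (d.-tuple (measurableTypeR R))) :
  measurable A -> INT (\1_A) = fine (borel_cube R d A).
Proof.
move=> mA; rewrite /INT /Rintegral integral_indic; last 2 first.
- exact: measurable_cube.
- exact: measurable_cube_type.
congr fine; rewrite -lebesgue_cubeE//; apply/eqP; rewrite eq_le; apply/andP; split.
  apply: le_measure; rewrite ?inE.
  - by apply: measurableI; [exact: measurable_cube_type | exact: measurable_cube].
  - exact: measurable_cube_type.
  - exact: subIsetl.
have mo := @measurable_open_cube R d.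
apply: (@le_trans _ _ (lebesgue_cube R d ((A `&` @cube R d) `|` ~` @open_cube R d))).
  apply: le_measure; rewrite ?inE.
  - exact: measurable_cube_type.
  - apply: measurableU; last exact/measurable_cube_type/measurableC.
    by apply: measurableI; [exact: measurable_cube_type | exact: measurable_cube].
  - move=> x Ax; have [ox|] := pselect (open_cube x); last by right.
    by left; split => //; exact: open_cubeW.
apply: (@le_trans _ _ (lebesgue_cube R d (A `&` @cube R d) +
                       lebesgue_cube R d (~` @open_cube R d))%E).
  apply: measureU2; last exact/measurable_cube_type/measurableC.
  by apply: measurableI; [exact: measurable_cube_type | exact: measurable_cube].
by rewrite lebesgue_cube_setC_open_cube adde0.
Qed.

Lemma borel_cube_bigsetU_le n (P : pred 'I_n)
    (A : 'I_n -> set (d.-tuple (measurableTypeR R))) (r : R) :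
  (forall i, measurable (A i)) ->
  (forall i, P i -> (borel_cube R d (A i) <= r%:E)%E) ->
  fine (borel_cube R d (\big[setU/set0]_(i < n | P i) A i)) <= \sum_(i < n | P i) r.
Proof.
move=> mA Ar; rewrite -lee_fin fineK; last first.
  by apply: fin_num_measure; exact: bigsetU_measurable.
apply: (le_trans (measure_bigsetU_le _ _ _ mA)).
by rewrite -sumEFin; apply: lee_sum.
Qed.

Lemma fine_borel_cube_setC (A : set (d.-tuple (measurableTypeR R))) :
  measurable A -> fine (borel_cube R d (~` A)) = 1 - fine (borel_cube R d A).
Proof.
move=> mA; have -> : borel_cube R d (~` A) = (1 - borel_cube R d A)%E.
  exact: probability_setC.
have fA : borel_cube R d A \is a fin_num by exact: fin_num_measure.
by rewrite -[X in (1 - X)%E](fineK fA).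
Qed.

End fooling.

(** An error of at most [delta / 4] forces [1 - n * q ^+ d <= 1 / 2]. *)
Lemma curse_from_fooling (R : realType) (p : \bar R) (p1 : (1 <= p)%E)
    (F : forall d, set (d.-tuple (measurableTypeR R) -> R)) (delta q : R) :
  0 < delta -> 0 < q < 1 ->
  (forall d (eps : R), (0 < d)%N -> 0 < eps ->
    (n_int (F d) eps <= n_app p1 (F d) eps)%E) ->
  (forall d n (t : seq R -> d.-tuple (measurableTypeR R)), (0 < d)%N ->
    (forall y, cube (t y)) -> exists f g,
    [/\ F d f, F d g, information t f n = information t g n &
        delta * (1 - n%:R * q ^+ d) <= INT g - INT f]) ->
  curse_of_dimensionality (fun d => n_app p1 (F d)).
Proof.
move=> delta0 /andP[q0 q1] Fle fool.
exists (delta / 4), (1 / 2), q^-1; split; rewrite ?divr_gt0 ?invf_gt1//.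
move=> d d0; apply: le_trans (Fle d _ d0 _); last by rewrite divr_gt0.
rewrite /n_int /complexity; case: pselect => [ex|_]; last exact: leey.
case: ex_minnP => n /asboolP en _; rewrite lee_fin.
have /le_trans/(_ en) := @e_int_ge_fooling R d (F d) n _ (fun t => fool d n t d0).
rewrite lee_fin exprVn => H.
have qd0 : 0 < q ^+ d by rewrite exprn_gt0.
rewrite ler_pdivrMr//.
have : 1 - n%:R * q ^+ d <= 1 / 2.
  by rewrite -(ler_pM2l delta0); move: H; lra.
lra.
Qed.

(** * The lower bound for monotone functions *)

Section monotone.
Variables (R : realType) (d : nat).
Implicit Types (x z : d.-tuple (measurableTypeR R)).

Let above z (i : 'I_d) : set (measurableTypeR R) := `[tnth z i, +oo[%classic.
Let below z (i : 'I_d) : set (measurableTypeR R) := `]-oo, tnth z i]%classic.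

Definition up_set z : set (d.-tuple (measurableTypeR R)) :=
  [set x | forall i, tnth z i <= tnth x i].

Definition down_set z : set (d.-tuple (measurableTypeR R)) :=
  [set x | forall i, tnth x i <= tnth z i].

Lemma measurable_box (A : 'I_d -> set (measurableTypeR R)) :
  (forall i, measurable (A i)) ->
  measurable [set x : d.-tuple (measurableTypeR R) | forall i, A i (tnth x i)].
Proof.
move=> mA; rewrite (_ : [set _ | _] = \bigcap_(i in [set: 'I_d])
    [set x : d.-tuple (measurableTypeR R) | A i (tnth x i)]); last first.
  by apply/seteqP; split => x /= Ax i; [move=> _|]; exact: Ax.
apply: fin_bigcap_measurable => // i _; rewrite -[X in measurable X]setTI.
exact: (@measurable_tnth _ (measurableTypeR R) d i).
Qed.

Lemma borel_cube_box_le (A : 'I_d -> set (measurableTypeR R)) (q : 'I_d -> R) :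
  (forall i, measurable (A i)) ->
  (forall i, (lebesgue01 (A i) <= (q i)%:E)%E) ->
  (borel_cube R d [set x | forall i, A i (tnth x i)] <= (\prod_(i < d) q i)%:E)%E.
Proof.
move=> mA Aq; apply: (@borel_cube_le_prod _ _ _ (fun i => \1_(A i))) => //.
- exact: measurable_box.
- move=> i; rewrite (_ : (\int[_]_x _)%E = lebesgue01 (A i))//.
  by rewrite integral_indic// setIT.
- move=> x Ax; rewrite big1// => i _; rewrite indicE mem_set//.
Qed.

Lemma measurable_up_set z : measurable (up_set z).
Proof.
rewrite (_ : up_set z = [set x | forall i, above z i (tnth x i)]).
  by apply: (@measurable_box (above z)) => i; exact: measurable_itv.
by apply/seteqP; split => x /= + i => /(_ i); rewrite /above/= in_itv/= andbT.
Qed.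

Lemma measurable_down_set z : measurable (down_set z).
Proof.
rewrite (_ : down_set z = [set x | forall i, below z i (tnth x i)]).
  by apply: (@measurable_box (below z)) => i; exact: measurable_itv.
by apply/seteqP; split => x /= + i => /(_ i); rewrite /below/= in_itv/=.
Qed.

Lemma borel_cube_up_set z : cube z ->
  (borel_cube R d (up_set z) <= (\prod_(i < d) (1 - tnth z i))%:E)%E.
Proof.
move=> cz.
rewrite (_ : up_set z = [set x | forall i, above z i (tnth x i)]); last first.
  by apply/seteqP; split => x /= + i => /(_ i); rewrite /above/= in_itv/= andbT.
apply: (@borel_cube_box_le (above z)) => i; first exact: measurable_itv.
have /andP[z0 z1] := cz i.
rewrite /lebesgue01 /mrestr (_ : _ `&` _ = [set` `[(tnth z i : R), 1]]).
  rewrite lebesgue_measure_itv/= lte_fin; case: ltP => [//|].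
  by rewrite lee_fin subr_ge0.
by apply/seteqP; split => x; rewrite /above/= !in_itv/=; lra.
Qed.

Lemma borel_cube_down_set z : cube z ->
  (borel_cube R d (down_set z) <= (\prod_(i < d) (tnth z i : R))%:E)%E.
Proof.
move=> cz.
rewrite (_ : down_set z = [set x | forall i, below z i (tnth x i)]); last first.
  by apply/seteqP; split => x /= + i => /(_ i); rewrite /below/= in_itv/=.
apply: (@borel_cube_box_le (below z)) => i; first exact: measurable_itv.
have /andP[z0 z1] := cz i.
rewrite /lebesgue01 /mrestr (_ : _ `&` _ = [set` `[0, (tnth z i : R)]]).
  rewrite lebesgue_measure_itv/= lte_fin; case: ltP => [|_].
    by rewrite sube0.
  by rewrite lee_fin.
by apply/seteqP; split => x; rewrite /below/= !in_itv/=; lra.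
Qed.

(** The answer of the adversary at [z]: whether the box above [z] is the smaller
    one of the two boxes cut off by [z]. *)
Definition upper_half z : bool :=
  \prod_(i < d) (1 - tnth z i) <= \prod_(i < d) (tnth z i : R).

Lemma upper_half_mono z x : cube z -> cube x ->
  (forall i, tnth z i <= tnth x i) -> upper_half z -> upper_half x.
Proof.
move=> cz cx zx zu.
apply: (@le_trans _ _ (\prod_(i < d) (1 - tnth z i))).
  by apply: ler_prod => i _; have := zx i; have := cx i; lra.
apply: le_trans zu _.
by apply: ler_prod => i _; have := zx i; have := cz i; lra.
Qed.

(** The square of the minimum is at most the product of the two volumes, and each
    factor [z (1 - z)] of that product is at most 1/4. *)
Lemma prod_min_le z : cube z ->
  Num.min (\prod_(i < d) (1 - tnth z i)) (\prod_(i < d) (tnth z i : R)) <= 2^-1 ^+ d.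
Proof.
move=> cz; set a := \prod_(i < d) _; set b := \prod_(i < d) _.
have a0 : 0 <= a by apply: prodr_ge0 => i _; have := cz i; lra.
have b0 : 0 <= b by apply: prodr_ge0 => i _; have := cz i; lra.
have ab : a * b <= (2^-1 ^+ d) ^+ 2.
  rewrite -exprM mulnC exprM -big_split/= -[in leRHS](card_ord d) -prodr_const.
  apply: ler_prod => i _; have := cz i => /andP[z0 z1].
  apply/andP; split; first by rewrite mulr_ge0// subr_ge0.
  have := sqr_ge0 (tnth z i - 2^-1 : R); nra.
have p0 : 0 <= 2^-1 ^+ d :> R by rewrite exprn_ge0.
rewrite -(@ler_pXn2r _ 2)// ?nnegrE ?le_min ?a0//.
apply: le_trans ab; rewrite expr2.
by apply: ler_pM; rewrite ?le_min ?a0// ge_min lexx ?orbT.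
Qed.

(** [U] is the set where the answers force the value 1, and [L] the set where they
    force the value 0.  As [upper_half] is itself monotone, [U] contains no point
    answered by 0 and [L] none answered by 1. *)
Lemma monotone_fooling n (t : seq R -> d.-tuple (measurableTypeR R)) :
  (forall y, cube (t y)) -> exists f g,
    [/\ F_mon f, F_mon g, information t f n = information t g n &
        1 * (1 - n%:R * 2^-1 ^+ d) <= INT g - INT f].
Proof.
move=> ct.
pose f0 x : R := (upper_half x)%:R.
pose s (i : 'I_n) := t (information t f0 i).
have cs i : cube (s i) by exact: ct.
pose P i := upper_half (s i).
pose U := \big[setU/set0]_(i < n | P i) up_set (s i).
pose L := \big[setU/set0]_(i < n | ~~ P i) down_set (s i).
have mU : measurable U.
  by apply: bigsetU_measurable => i _; exact: measurable_up_set.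
have mL : measurable L.
  by apply: bigsetU_measurable => i _; exact: measurable_down_set.
have UE x : U x <-> exists2 i, P i & up_set (s i) x.
  rewrite /U -bigcup_seq_cond; split=> [[i /= /andP[_ Pi] ix]|[i Pi ix]].
    by exists i.
  by exists i => //=; rewrite mem_index_enum.
have LE x : L x <-> exists2 i, ~~ P i & down_set (s i) x.
  rewrite /L -bigcup_seq_cond; split=> [[i /= /andP[_ Pi] ix]|[i Pi ix]].
    by exists i.
  by exists i => //=; rewrite mem_index_enum.
have U0 i : s i \in U = P i.
  apply/idP/idP => [/set_mem/UE[j Pj sji]|Pi]; first exact: upper_half_mono Pj.
  by apply/mem_set/UE; exists i => // j.
have L0 i : s i \in ~` L = P i.
  apply/idP/idP => [/set_mem Li|Pi].
    by apply: contra_notT Li => Pi; apply/LE; exists i => // j.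
  apply/mem_set => /LE[j /negP Pj sij]; apply: Pj.
  exact: upper_half_mono Pi.
have indic_unit (A : set (d.-tuple (measurableTypeR R))) : unit_valued (\1_A : _ -> R).
  by move=> x _; rewrite indicE; case: (_ \in _); rewrite ?lexx ler01.
have indic_mono (A : set (d.-tuple (measurableTypeR R))) :
    (forall x y, (forall j, tnth x j <= tnth y j) -> A x -> A y) ->
    F_mon (\1_A : _ -> R).
  move=> Amono; split=> // i x y cx cy xy xyi.
  have {xyi} le j : tnth x j <= tnth y j.
    by have [->//|/xy ->] := eqVneq j i.
  rewrite !indicE; have [Ax|Ax] := pselect (A x).
    by rewrite !mem_set//; exact: Amono Ax.
  by rewrite [x \in A]memNset//; case: (_ \in _); rewrite ?lexx ?ler01.
exists (\1_U), (\1_(~` L)); split.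
- apply: indic_mono => x y xy /UE[i Pi ix]; apply/UE; exists i => // j.
  exact: le_trans (ix j) (xy j).
- apply: indic_mono => x y xy Lx; apply: contra_not Lx => /LE[i Pi iy].
  by apply/LE; exists i => // j; exact: le_trans (xy j) (iy j).
- transitivity (information t f0 n); [|symmetry]; apply: eq_information => k kn.
    by rewrite indicE (U0 (Ordinal kn)).
  by rewrite indicE (L0 (Ordinal kn)).
rewrite mul1r !INT_indic//; last exact: measurableC.
rewrite fine_borel_cube_setC//.
have Ub : fine (borel_cube R d U) <= \sum_(i < n | P i) 2^-1 ^+ d.
  apply: borel_cube_bigsetU_le => i; first exact: measurable_up_set.
  move=> Pi; apply: le_trans (borel_cube_up_set (cs i)) _; rewrite lee_fin.
  by have := prod_min_le (cs i); rewrite min_l.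
have Lb : fine (borel_cube R d L) <= \sum_(i < n | ~~ P i) 2^-1 ^+ d.
  apply: borel_cube_bigsetU_le => i; first exact: measurable_down_set.
  rewrite -ltNge => /ltW Pi; apply: le_trans (borel_cube_down_set (cs i)) _.
  by rewrite lee_fin; have := prod_min_le (cs i); rewrite min_r.
have : n%:R * 2^-1 ^+ d = \sum_(i < n | P i) 2^-1 ^+ d +
    \sum_(i < n | ~~ P i) 2^-1 ^+ d :> R.
  by rewrite -(bigID P xpredT)/= sumr_const card_ord mulr_natl.
lra.
Qed.

End monotone.

(** * The lower bound for convex functions *)

Section convex.
Variables (R : realType) (d : nat).
Implicit Types (x y z : d.-tuple (measurableTypeR R)).

(** A quadratic upper bound of [expR v] for [v] equal to
    [(1/24 - (u - 1/2) (u - a)) / 24]: since [v] has absolute value at most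
    [1/48], one has [expR v <= 1 + v + 2 v^2 <= 1 + v + 1/1152].  A polynomial is
    used because its integral is explicit. *)
Definition weight (a : R) (u : measurableTypeR R) : R :=
  1 + (24^-1 - (u - 2^-1) * (u - a)) / 24 + 1152^-1.

Lemma expR_le_weight (a u : R) : 0 <= a <= 1 -> 0 <= u <= 1 ->
  expR ((24^-1 - (u - 2^-1) * (u - a)) / 24) <= weight a u.
Proof.
move=> a01 u01; rewrite /weight; set v := _ / 24.
have [v1 v2] : - 48^-1 <= v /\ v <= 48^-1 by rewrite /v; split; nra.
rewrite -[expR v]invrK -expRN.
apply: (@le_trans _ _ (1 - v)^-1).
  by rewrite lef_pV2 ?posrE ?expR_gt0 ?expR_ge1Dx//; lra.
rewrite -[(1 - v)^-1]mul1r ler_pdivrMr; last lra.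
have v3 : v ^+ 2 <= 2304^-1 by rewrite expr2; nra.
have v0 := sqr_ge0 v; rewrite expr2 in v0 v3; nra.
Qed.

(** The mean of [(u - 1/2) (u - a)] is [1/12] for every [a], so the integral is
    [1 + (1/24 - 1/12) / 24 + 1/1152 = 1151/1152]; the parameter 1/24 of the
    exponential is chosen to make this smaller than 1.  The absolute value only
    makes the weight nonnegative outside of the unit interval. *)
Lemma integral_weight (a : R) : 0 <= a <= 1 ->
  (\int[@lebesgue01 R]_u (`|weight a u|)%:E <= (1151 / 1152)%:E)%E.
Proof.
move=> a01.
pose Q : {poly R} := (1 + 576^-1 + 1152^-1 - a / 48)%:P * 'X +
  ((a + 2^-1) / 48)%:P * 'X^2 - (72^-1)%:P * 'X^3.
have QE u : (Q^`()).[u] = weight a u.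
  rewrite /Q !poly.derivE !hornerE /weight; by field.
have wE : weight a = horner Q^`() :> (R -> R) by apply/funext => u; rewrite QE.
have mw : measurable_fun [set: measurableTypeR R] (weight a : measurableTypeR R -> R).
  by rewrite wE; apply: continuous_measurable_fun; exact: continuous_horner.
rewrite ge0_integral_lebesgue01; last 2 first.
- by apply/measurable_EFinP; apply: measurableT_comp mw.
- by move=> u; rewrite lee_fin.
under eq_integral => u.
  rewrite inE/= in_itv/= => u01.
  rewrite ger0_norm; last first.
    by apply: le_trans (expR_le_weight a01 u01); exact: expR_ge0.
  rewrite -QE; over.
rewrite (@continuous_FTC2 _ _ (horner Q)).
- rewrite -EFinB lee_fin /Q !hornerE ?expr1n ?expr0n/=; lra.
- exact: ltr01.
- by apply: continuous_subspaceT; exact: continuous_horner.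
- split.
  + by move=> u _; exact: derivable_horner.
  + by apply: cvg_at_right_filter; exact: continuous_horner.
  + by apply: cvg_at_left_filter; exact: continuous_horner.
- by move=> u _; rewrite -derivE.
Qed.

(** The inner product of [x - c] and [x - z], where [c] is the centre of the cube.
    It is nonpositive exactly when [x] is in the closed ball that has the segment
    from [c] to [z] as a diameter, and these balls cover the convex hull of the
    points [z]. *)
Definition center_dot x z : R :=
  \sum_(i < d) (tnth x i - 2^-1) * (tnth x i - tnth z i).

Definition near_center z : set (d.-tuple (measurableTypeR R)) :=
  [set x | center_dot x z < d%:R / 24].

Lemma center_factor_ge (u v : R) : 0 <= u <= 1 -> 0 <= v <= 1 ->
  - 16^-1 <= (u - 2^-1) * (u - v).
Proof.
move=> /andP[u0 u1] /andP[v0 v1]; have [hu|/ltW hu] := leP 2^-1 u.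
  have : 0 <= (u - 2^-1) * (1 - v) by rewrite mulr_ge0; lra.
  have := sqr_ge0 (u - 3 / 4); rewrite expr2; lra.
have : 0 <= (2^-1 - u) * v by rewrite mulr_ge0; lra.
have := sqr_ge0 (u - 4^-1); rewrite expr2; lra.
Qed.

Lemma measurable_near_center z : measurable (near_center z).
Proof.
rewrite (_ : near_center z = center_dot ^~ z @^-1` [set` `]-oo, (d%:R / 24 : R)[]); last first.
  by apply/seteqP; split => x /=; rewrite in_itv.
rewrite -[X in measurable X]setTI.
suff : measurable_fun [set: d.-tuple (measurableTypeR R)] (center_dot ^~ z).
  by apply => //; exact: measurable_itv.
apply: measurable_sum => i.
have mi : measurable_fun [set: d.-tuple (measurableTypeR R)]
    (fun x => tnth x i : R) by exact: measurable_tnth.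
by apply: measurable_funM; apply: measurable_funB => //; exact: measurable_cst.
Qed.

(** Chernoff's method: on this set the product of the exponentials bounded by
    [weight] is at least 1. *)
Lemma borel_cube_near_center z : cube z ->
  (borel_cube R d (near_center z) <= ((1151 / 1152) ^+ d)%:E)%E.
Proof.
move=> cz; have mo := @measurable_open_cube R d.
have mz := measurable_near_center z.
apply: (@le_trans _ _ (borel_cube R d (near_center z `&` @open_cube R d) +
                       borel_cube R d (~` @open_cube R d))%E).
  apply: (@le_trans _ _ (borel_cube R d ((near_center z `&` @open_cube R d) `|`
                                          ~` @open_cube R d))).
    apply: le_measure; rewrite ?inE//.
      by apply: measurableU; [exact: measurableI | exact: measurableC].
    move=> x zx; have [ox|] := pselect (open_cube x); last by right.
    by left.
  by apply: measureU2; [exact: measurableI | exact: measurableC].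
rewrite borel_cube_setC_open_cube adde0.
rewrite -[in leRHS](card_ord d) -prodr_const.
apply: (@borel_cube_le_prod _ _ _ (fun i u => `|weight (tnth z i) u|)) => //.
- exact: measurableI.
- move=> i; apply: measurableT_comp => //.
  rewrite /weight; apply: measurable_funD; last exact: measurable_cst.
  apply: measurable_funD; first exact: measurable_cst.
  apply: measurable_funM; last exact: measurable_cst.
  apply: measurable_funB; first exact: measurable_cst.
  apply: measurable_funM; apply: measurable_funB; try exact: measurable_cst.
    exact: measurable_id.
  exact: measurable_id.
- by move=> i; apply: integral_weight; exact: cz.
- move=> x [zx /open_cubeW cx].
  apply: (@le_trans _ _ (\prod_(i < d)
    expR ((24^-1 - (tnth x i - 2^-1) * (tnth x i - tnth z i)) / 24))).
    rewrite -expR_sum -[leLHS]expR0 ler_expR -mulr_suml divr_ge0//.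
    rewrite sumrB sumr_const card_ord -[_ *+ d]mulr_natl subr_ge0.
    exact: ltW.
  apply: ler_prod => i _; rewrite expR_ge0/=.
  by apply: le_trans (ler_norm _); apply: expR_le_weight.
Qed.

Lemma INT_cst0 : INT (cst 0 : d.-tuple (measurableTypeR R) -> R) = 0.
Proof. by rewrite /INT Rintegral_cst ?mul0r//; exact: measurable_cube. Qed.

Lemma F_con_cst0 : F_con (cst 0 : d.-tuple (measurableTypeR R) -> R).
Proof.
split=> [x _|t x y _ _ _] /=; first by rewrite lexx ler01.
by rewrite !mulr0 addr0.
Qed.

(** The bound at a point [x] far from the balls of all sample points is witnessed by
    the affine function [h y = 1/12 - 2/d <x - c, x - y>]: it equals 1/12 at [x],
    it is at most 0 at the sample points by the choice of [x], and it is at most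
    [1/12 + 1/8] on the cube, since every coordinate contributes at least [-1/16]
    to the inner product. *)
Lemma convex_fooling n (t : seq R -> d.-tuple (measurableTypeR R)) :
  (0 < d)%N -> (forall v : seq R, cube (t v)) -> exists f g,
    [/\ F_con f, F_con g, information t f n = information t g n &
        12^-1 * (1 - n%:R * (1151 / 1152) ^+ d) <= INT g - INT f].
Proof.
move=> d0 ct.
pose f0 : d.-tuple (measurableTypeR R) -> R := cst 0.
pose s (j : 'I_n) := t (information t f0 j).
have cs j : cube (s j) by exact: ct.
pose G : set (d.-tuple (measurableTypeR R) -> R) := [set h |
  [/\ (forall (c : R) x y, 0 <= c <= 1 -> cube x -> cube y ->
         h (segment_point c x y) <= c * h x + (1 - c) * h y),
      (forall x, cube x -> h x <= 1) &
      (forall j, h (s j) <= 0)]].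
pose g x := sup [set h x | h in G].
have G0 : G f0.
  by split=> [c x y _ _ _|x _|j] /=; rewrite /f0 ?mulr0 ?addr0.
have gne x : [set h x | h in G] !=set0 by exists (f0 x); exists f0.
have gub x : cube x -> has_ubound [set h x | h in G].
  by move=> cx; exists 1 => _ [h [_ h1 _] <-]; exact: h1.
have leg h x : G h -> cube x -> h x <= g x.
  by move=> Gh cx; apply: ub_le_sup; [exact: gub | exists h].
have Fg : F_con g.
  split=> [x cx|c x y c01 cx cy].
    rewrite (leg f0 x G0 cx)/=; apply: ge_sup => // _ [h [_ h1 _] <-].
    exact: h1.
  apply: ge_sup => // _ [h Gh <-]; have [hc _ _] := Gh.
  apply: le_trans (hc _ _ _ c01 cx cy) _.
  move: c01 => /andP[c0 c1].
  by apply: lerD; rewrite ler_wpM2l ?subr_ge0// leg.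
have gs j : g (s j) = 0.
  apply/eqP; rewrite eq_le (leg f0 _ G0 (cs j)) andbT.
  by apply: ge_sup => // _ [h [_ _ hs] <-].
pose B := \big[setU/set0]_(j < n) near_center (s j).
have mB : measurable B.
  by apply: bigsetU_measurable => j _; exact: measurable_near_center.
have dR : 0 < d%:R :> R by rewrite ltr0n.
have gB x : cube x -> 12^-1 * \1_(~` B) x <= g x.
  move=> cx; have [Bx|Bx] := pselect (B x).
    by rewrite indicE memNset ?mulr0; [exact: (leg f0 x G0 cx) | exact].
  rewrite indicE mem_set// mulr1.
  have far j : d%:R / 24 <= center_dot x (s j).
    rewrite leNgt; apply/negP => xj; apply: Bx.
    by rewrite /B -bigcup_seq; exists j => //=; rewrite mem_index_enum.
  pose h y := 12^-1 - 2 / d%:R * center_dot x y.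
  have hx : h x = 12^-1.
    by rewrite /h /center_dot big1 ?mulr0 ?subr0// => i _; rewrite subrr mulr0.
  (* The affine function [h] is one of the competitors in the supremum [g]. *)
  rewrite -hx; apply: leg => //; split.
  - move=> c y z c01 cy cz; rewrite le_eqVlt; apply/orP; left; apply/eqP.
    rewrite /h; have -> : center_dot x (segment_point c y z) =
        c * center_dot x y + (1 - c) * center_dot x z.
      rewrite /center_dot !mulr_sumr -big_split/=; apply: eq_bigr => i _.
      by rewrite tnth_mktuple; ring.
    by ring.
  - move=> y cy; have : - (d%:R / 16) <= center_dot x y.
      have -> : - (d%:R / 16) = \sum_(i < d) (- 16^-1 : R).
        by rewrite sumr_const card_ord -[RHS]mulr_natl mulrN.
      by apply: ler_sum => i _; exact: center_factor_ge (cx i) (cy i).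
    move=> H; have : 2 / d%:R * - (d%:R / 16) <= 2 / d%:R * center_dot x y.
      by rewrite ler_wpM2l ?divr_ge0.
    have -> : 2 / d%:R * - (d%:R / 16) = - 8^-1 :> R by field; rewrite gt_eqF.
    by rewrite /h; lra.
  - move=> j; have : 2 / d%:R * (d%:R / 24) <= 2 / d%:R * center_dot x (s j).
      by rewrite ler_wpM2l ?divr_ge0.
    have -> : 2 / d%:R * (d%:R / 24) = 12^-1 :> R by field; rewrite gt_eqF.
    by rewrite /h; lra.
exists f0, g; split => //; first exact: F_con_cst0.
  by symmetry; apply: eq_information => k kn; exact: (gs (Ordinal kn)).
rewrite INT_cst0 subr0.
have mBc : measurable (~` B) by exact: measurableC.
have ind_int : (lebesgue_cube R d).-integrable (@cube R d)
    (EFin \o (\1_(~` B) : d.-tuple (measurableTypeR R) -> R)).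
  apply: unit_valued_integrable.
    by move=> x _; rewrite indicE; case: (_ \in _); rewrite ?lexx ler01.
  by apply: measurable_indic; exact: measurable_cube_type.
apply: (@le_trans _ _ (12^-1 * INT (\1_(~` B)))).
  rewrite ler_wpM2l ?invr_ge0// INT_indic// fine_borel_cube_setC// lerB//.
  have := @borel_cube_bigsetU_le R d n xpredT (near_center \o s) ((1151 / 1152) ^+ d)
    (fun j => measurable_near_center (s j)) (fun j _ => borel_cube_near_center (cs j)).
  by rewrite sumr_const card_ord -[X in _ <= X -> _]mulr_natl.
rewrite /INT -RintegralZl//; last exact: measurable_cube.
apply: le_Rintegral => //.
- exact: measurable_cube.
- have := integrableZl (@measurable_cube R d) (12^-1) ind_int.
  by apply: eq_integrable => //; exact: measurable_cube.
- by apply: unit_valued_integrable; [exact: Fg.1 | exact: F_con_measurable].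
Qed.

End convex.

(** * Comparison and curse of dimensionality *)

Theorem mainTheorem3 (R : realType) (p : \bar R) (p1 : (1 <= p)%E) :
  (forall (d : nat) (F : set (d.-tuple (measurableTypeR R) -> R)),
     (0 < d)%N -> F = @F_mon R d \/ F = @F_con R d ->
     forall (n : nat) (eps : R), 0 < eps ->
       (e_int F n <= e_app p1 F n)%E /\ (n_int F eps <= n_app p1 F eps)%E)
  /\ curse_of_dimensionality (fun d => n_app p1 (@F_mon R d))
  /\ curse_of_dimensionality (fun d => n_app p1 (@F_con R d)).
Proof.
have le_e d (F : set (d.-tuple (measurableTypeR R) -> R)) n :
    F = @F_mon R d \/ F = @F_con R d -> (e_int F n <= e_app p1 F n)%E.
  by move=> [->|->]; apply: e_int_le_e_app => f Ff;
    [exact: Ff.1 | exact: F_mon_measurable | exact: Ff.1 | exact: F_con_measurable].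
have le_n d (F : set (d.-tuple (measurableTypeR R) -> R)) eps :
    F = @F_mon R d \/ F = @F_con R d -> (n_int F eps <= n_app p1 F eps)%E.
  by move=> HF; apply: complexity_le => n; exact: le_e.
split; [by move=> d F _ HF n eps _; split; [exact: le_e | exact: le_n] | split].
- apply: (@curse_from_fooling R p p1 (@F_mon R) 1 2^-1) => //.
  + by apply/andP; split; lra.
  + by move=> d eps _ _; apply: le_n; left.
  + by move=> d n t _; exact: monotone_fooling.
- apply: (@curse_from_fooling R p p1 (@F_con R) 12^-1 (1151 / 1152)) => //.
  + by apply/andP; split; lra.
  + by move=> d eps _ _; apply: le_n; right.
  + by move=> d n t; exact: convex_fooling.
Qed.
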